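(* The structure $\mathfrak B_1$ can be defined in terms of both $\mathfrak B_2$ and $\mathfrak C_2$ (i.e. $\mathfrak B_1$ is definable in terms of $\mathfrak B_2$, and it is definable in terms of $\mathfrak C_2$).
   Context: Setting. $\mathfrak F$ is a perfect field of characteristic $2$, $\mathbb V$ is a vector space over $\mathfrak F$ of finite dimension, and $\mathfrak P$ is the projective space of $\mathbb V$ (points are $\langle u\rangle$ with $u\in\mathbb V$ nonzero). Lines of $\mathfrak P$ have at least $6$ points. $\xi$ is a nondegenerate symmetric bilinear form on $\mathbb V$ which is not alternating, and $\langle u\rangle\perp\langle v\rangle$ means $\xi(u,v)=0$. The set $\mathbf H$ of selfconjugate points ($p\perp p$) is then a hyperplane of $\mathfrak P$, and its pole is a point $\mathbf b$ (so $\mathbf b^\perp=\mathbf H$); $\mathbf b$ may or may not lie on $\mathbf H$. For a subspace $U$ of $\mathfrak P$, $\dim(U)$ is the vector dimension (points have dimension $1$, lines $2$, planes $3$), $U^\perp=\{p: p\perp q\text{ for all }q\in U\}$, and $U$ is regular if $U\cap U^\perp=\emptyset$. $\mathscr R_k$ is the set of regular $k$-dimensional subspaces. Regular points are exactly the points not on $\mathbf H$. Structures (incidence is inclusion throughout). $\mathfrak B_1$: points are the regular points different from $\mathbf b$, lines are the regular lines not contained in $\mathbf H$. $\mathfrak B_2=\langle\mathscr R_2^\circ,\mathscr R_3,\subset\rangle$: points are the regular lines not through $\mathbf b$ (the set $\mathscr R_2^\circ$), lines are the regular planes. $\mathfrak C_2$: points are the regular lines which are not contained in $\mathbf H$ and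 do not pass through $\mathbf b$, lines are the regular planes. Definability. Let $M,N$ be structures whose elements are points or subspaces of $\mathfrak P$. $N$ is definable in terms of $M$ if it can be described using only the primitive notions of $M$: the elements of $N$ can be represented by tuples of elements of $M$ ranging over sets given by parameter-free first-order formulas in the language of $M$, modulo equivalence relations given by such formulas, in such a way that all the primitive relations of $N$, and the natural inclusion relations between elements of $N$ and elements of $M$ (as subspaces of $\mathfrak P$), are given by such formulas as well.
   Formalization: The dimension of V is assumed to be neither 2 nor 3: in dimension 2, B_2 and C_2 are empty while B_1 has several points; in dimension 3 the whole space is the only regular plane, so all permutations of points are automorphisms and B_1 is not definable. *)

(* Defs.v *)
From mathcomp Require Import all_boot all_algebra.

Set Implicit Arguments.
Unset Strict Implicit.
Unset Printing Implicit Defensive.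

Import GRing.Theory.
Local Open Scope ring_scope.
Local Open Scope nat_scope.

(* In characteristic 0 the condition is void. *)
Definition perfect_field (F : fieldType) : Prop :=
  forall p : nat, p \in [pchar F] -> forall x : F, exists y : F, x = (y ^+ p)%R.

Section Structures.
Variables (F : fieldType) (V : vectType F).

Record incidence_structure := IncidenceStructure {
  points : pred {vspace V};
  lines : pred {vspace V} }.

Inductive sort := Point | Line.

Definition has_sort (M : incidence_structure) (s : sort) : pred {vspace V} :=
  match s with Point => points M | Line => lines M end.

Definition element (M : incidence_structure) : Type :=
  {U : {vspace V} | points M U || lines M U}.

End Structures.

(* [formula k] is the type of formulas whose free variables are among
   x_0, ..., x_(k-1).  The language has equality, a predicate for each of the
   two sorts, and the incidence relation.  [FEx] binds the variable x_0 of its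
   argument; the free variable x_i of [FEx f] is x_(i+1) inside f. *)
Inductive formula : nat -> Type :=
| FEq k (i j : 'I_k) : formula k
| FSort k (s : sort) (i : 'I_k) : formula k
| FInc k (i j : 'I_k) : formula k
| FNot k (f : formula k) : formula k
| FAnd k (f g : formula k) : formula k
| FEx k (f : formula k.+1) : formula k.

Section Semantics.
Variables (F : fieldType) (V : vectType F).

Fixpoint holds (M : incidence_structure V) k (f : formula k) :
    k.-tuple (element M) -> Prop :=
  match f in formula k return k.-tuple (element M) -> Prop with
  | FEq _ i j => fun e => tnth e i = tnth e j
  | FSort _ s i => fun e => has_sort M s (val (tnth e i))
  | FInc _ i j => fun e =>
      [/\ points M (val (tnth e i)), lines M (val (tnth e j)) &
          (val (tnth e i) <= val (tnth e j))%VS]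
  | FNot _ f => fun e => ~ holds f e
  | FAnd _ f g => fun e => holds f e /\ holds g e
  | FEx _ f => fun e => exists x, holds f [tuple of x :: e]
  end.

(* The elements of N of sort s are represented by the tuples of length
   [len s] of elements of M that satisfy [dom s]; the tuple t represents the
   element [repr s t] (the value of [repr] outside [dom s] is irrelevant), and
   [eqv s] says when two tuples represent the same element.  The formulas
   [below] and [above] define the inclusions between elements of N and
   elements of M, regarded as subspaces of V. *)
Definition definable_in_terms_of (N M : incidence_structure V) : Prop :=
  exists (len : sort -> nat)
         (dom : forall s, formula (len s))
         (eqv : forall s, formula (len s + len s))
         (repr : forall s, (len s).-tuple (element M) -> {vspace V}),
  [/\ forall s t, holds (dom s) t -> has_sort N s (repr s t),
      forall s U, has_sort N s U -> exists2 t, holds (dom s) t & repr s t = U,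
      forall s t t', holds (dom s) t -> holds (dom s) t' ->
        (holds (eqv s) [tuple of t ++ t'] <-> repr s t = repr s t'),
      exists inc : formula (len Point + len Line),
        forall t t', holds (dom Point) t -> holds (dom Line) t' ->
          (holds inc [tuple of t ++ t'] <->
           (repr Point t <= repr Line t')%VS) &
      forall s, exists below above : formula (len s).+1,
        forall t (m : element M), holds (dom s) t ->
          (holds below [tuple of m :: t] <-> (repr s t <= val m)%VS) /\
          (holds above [tuple of m :: t] <-> (val m <= repr s t)%VS)].

End Semantics.

Section Regular.
Variables (F : fieldType) (V : vectType F) (xi : {symmetric V}).

Definition selfconjugate (p : {vspace V}) : bool := (p <= orthov xi p)%VS.

Definition regular (U : {vspace V}) : bool := (U :&: orthov xi U == 0)%VS.

Definition is_selfconjugate_locus (H : {vspace V}) : Prop :=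
  forall p : {vspace V}, \dim p = 1 -> (p <= H)%VS = selfconjugate p.

Definition is_pole (b H : {vspace V}) : Prop :=
  \dim b = 1 /\ orthov xi b = H.

Definition regular_of_dim (k : nat) (U : {vspace V}) : bool :=
  (\dim U == k) && regular U.

Definition B1 (H b : {vspace V}) : incidence_structure V :=
  {| points := fun U => regular_of_dim 1 U && (U != b);
     lines := fun U => regular_of_dim 2 U && ~~ (U <= H)%VS |}.

Definition B2 (b : {vspace V}) : incidence_structure V :=
  {| points := fun U => regular_of_dim 2 U && ~~ (b <= U)%VS;
     lines := fun U => regular_of_dim 3 U |}.

Definition C2 (H b : {vspace V}) : incidence_structure V :=
  {| points := fun U =>
       [&& regular_of_dim 2 U, ~~ (U <= H)%VS & ~~ (b <= U)%VS];
     lines := fun U => regular_of_dim 3 U |}.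

End Regular.

Definition lines_have_at_least (F : fieldType) (V : vectType F) (n : nat) :=
  forall L : {vspace V}, \dim L = 2 ->
  exists s : seq {vspace V}, [/\ uniq s, size s = n &
    forall p, p \in s -> \dim p = 1 /\ (p <= L)%VS].

(* Main.v *)
Require Import Defs.
From mathcomp Require Import all_boot all_algebra.
From mathcomp Require Import ring.
From Stdlib Require Import Classical.

Set Implicit Arguments.
Unset Strict Implicit.
Unset Printing Implicit Defensive.

Import GRing.Theory.
Local Open Scope ring_scope.

(** Over a perfect field of characteristic two the map [u |-> xi u u] is the
    square of a linear form [lam u = xi beta u], where [beta] spans the pole [b]
    and the kernel of [lam] is [H].  Then [eta u v = xi u v - lam u * lam v] is
    an alternating form, and regularity becomes a condition on [eta] and [lam]:
    a line [<p, y>] is regular iff [eta p y] is nonzero, and a plane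
    [<p, y, z>] is regular iff the value at [(p, y, z)] of the exterior product
    [om] of [lam] and [eta] is nonzero.  So the restriction of [eta] to a
    regular plane has a one-dimensional radical, and this radical is a point off
    [H]; conversely, in dimension at least four, every point off [H] other than
    [b] is the radical of a regular plane.  (In dimension one, B1 is empty.)  The
    points of B1 can therefore be coded by the regular planes, and the whole
    problem is to define, in terms of lines and planes, when the radical of a
    plane [A] lies on a line [m] ([radical_on]).

    The definition uses auxiliary points, given as intersections of two lines
    [a], [b] in a common regular plane.  Three pairwise coplanar lines that are
    not in one plane are concurrent; linking two such configurations defines
    when a third line passes through the intersection of [a] and [b]
    ([through]).  This is complete because a line through a given point can be
    chosen outside finitely many proper subspaces ([avoid]), and the field has
    at least eight elements.  A point [p] is then seen to lie in [A] when some
    line of the geometry through [p] is contained in [A] ([visible]), which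
    happens for all the points of [A] but its radical ([visibleP]).  It remains
    to distinguish the radical from the points outside [A], which are not
    visible either:
    - no line of the geometry joins the radical to a point visible in [A],
      whereas in dimension four a point outside [A] can be so joined
      ([outside_joined]);
    - a plane [B] containing the radical and a visible point [q] of [A] contains
      their whole joining line, so it shares with [A] a visible point other than
      [q], whereas in dimension at least five, [B] can be chosen through a point
      outside [A] so as to meet [A] in [q] only ([outside_meets_once]).
    The two conditions together define the radical ([radical_atP]).

    The lines of B1 are joins of two points off [H] that are not orthogonal for
    [eta].  If such a line avoids [b], it is an element of the given structure;
    if it passes through [b], it is recognized by the fact that no regular plane
    contains it, while two distinct orthogonal points off [H] and other than [b]
    do lie in a regular plane ([represents_lineP], [radical_on_lineP]).  The
    argument is the same for B2 and C2. *)

(** * Spans of few vectors, and vectors avoiding proper subspaces *)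

Section Spans.

Variables (F : fieldType) (V : vectType F).
Implicit Types (u v w x : V) (U W : {vspace V}).

Lemma mem_span2 u v x :
  x \in (<[u]> + <[v]>)%VS -> exists a b, x = a *: u + b *: v.
Proof.
by case/memv_addP=> _ /vlineP[a ->] [_ /vlineP[b ->] ->]; exists a, b.
Qed.

Lemma mem_span3 u v w x : x \in (<[u]> + <[v]> + <[w]>)%VS ->
  exists a b c, x = a *: u + b *: v + c *: w.
Proof.
case/memv_addP=> _ /mem_span2[a [b ->]] [_ /vlineP[c ->] ->].
by exists a, b, c.
Qed.

Lemma dim_add_line U x : x \notin U -> \dim (U + <[x]>)%VS = (\dim U).+1.
Proof.
move=> xU; have x0 : x != 0 by apply: contraNneq xU => ->; rewrite mem0v.
rewrite dimv_disjoint_sum ?dim_vline ?x0 ?addn1 //.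
apply/eqP; rewrite -subv0; apply/subvP => v /memv_capP[vU /vlineP[k vE]].
move: vU; rewrite vE memv0; have [->|k0 kxU] := eqVneq k 0; first by rewrite scale0r.
by case/negP: xU; rewrite -[x](scalerK k0) memvZ.
Qed.

Lemma dim_span2 u v : u != 0 -> v \notin <[u]>%VS -> \dim (<[u]> + <[v]>)%VS = 2%N.
Proof. by move=> u0 vu; rewrite dim_add_line // dim_vline u0. Qed.

Lemma dim_span2_le u v : (\dim (<[u]> + <[v]>)%VS <= 2)%N.
Proof.
apply: leq_trans (_ : \dim <[u]> + \dim <[v]> <= 2)%N; last first.
  by rewrite !dim_vline; case: (u != 0); case: (v != 0).
by rewrite -dimv_sum_cap leq_addr.
Qed.

Lemma dim_span3_le u v w : (\dim (<[u]> + <[v]> + <[w]>)%VS <= 3)%N.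
Proof.
apply: leq_trans (_ : \dim (<[u]> + <[v]>)%VS + \dim <[w]> <= 3)%N.
  by rewrite -dimv_sum_cap leq_addr.
by apply: (@leq_add _ _ 2 1); rewrite ?dim_span2_le // dim_vline; case: (w != 0).
Qed.

Lemma sub_span2 u v W : u \in W -> v \in W -> (<[u]> + <[v]> <= W)%VS.
Proof. by rewrite subv_add -!memvE => -> ->. Qed.

Lemma sub_span3 u v w W :
  u \in W -> v \in W -> w \in W -> (<[u]> + <[v]> + <[w]> <= W)%VS.
Proof. by move=> uW vW wW; rewrite subv_add sub_span2 //= -memvE. Qed.

Lemma mem_span2l u v : u \in (<[u]> + <[v]>)%VS.
Proof. by rewrite memvE addvSl. Qed.

Lemma mem_span2r u v : v \in (<[u]> + <[v]>)%VS.
Proof. by rewrite memvE addvSr. Qed.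

Lemma mem_span3l u v w : u \in (<[u]> + <[v]> + <[w]>)%VS.
Proof. by apply: (subvP (addvSl _ _)); apply: mem_span2l. Qed.

Lemma mem_span3m u v w : v \in (<[u]> + <[v]> + <[w]>)%VS.
Proof. by apply: (subvP (addvSl _ _)); apply: mem_span2r. Qed.

Lemma mem_span3r u v w : w \in (<[u]> + <[v]> + <[w]>)%VS.
Proof. by rewrite memvE addvSr. Qed.

Lemma span2_eq U u v : (\dim U <= 2)%N -> u \in U -> v \in U ->
  u != 0 -> v \notin <[u]>%VS -> U = (<[u]> + <[v]>)%VS.
Proof.
move=> dU uU vU u0 vu; apply/esym/eqP.
by rewrite eqEdim sub_span2 //= dim_span2.
Qed.

Lemma span3_eq U u v w : (\dim U <= 3)%N -> u \in U -> v \in U -> w \in U ->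
  u != 0 -> v \notin <[u]>%VS -> w \notin (<[u]> + <[v]>)%VS ->
  U = (<[u]> + <[v]> + <[w]>)%VS.
Proof.
move=> dU uU vU wU u0 vu wuv; apply/esym/eqP.
by rewrite eqEdim sub_span3 //= dim_add_line // dim_span2.
Qed.

Lemma dim_lt_notin U W : (\dim W < \dim U)%N -> exists2 v, v \in U & v \notin W.
Proof. by move=> d; apply/subvPn; apply: contraL d => /dimvS; rewrite -leqNgt. Qed.

Lemma vline_sym u v : u != 0 -> u \in <[v]>%VS -> v \in <[u]>%VS.
Proof.
move=> u0 /vlineP[k uE]; have k0 : k != 0.
  by apply: contraNneq u0 => k0; rewrite uE k0 scale0r.
by apply/vlineP; exists k^-1; rewrite uE scalerK.
Qed.

Lemma vline_trans u v U : u \in <[v]>%VS -> v \in U -> u \in U.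
Proof. by case/vlineP=> k -> vU; rewrite memvZ. Qed.

Lemma vline_eq u v : u != 0 -> u \in <[v]>%VS -> <[u]>%VS = <[v]>%VS.
Proof.
move=> u0 uv; apply/eqP; rewrite eqEsubv -!memvE uv /=; exact: vline_sym.
Qed.

Lemma mem_add_swap U v w : w \notin U -> w \in (U + <[v]>)%VS ->
  v \in (U + <[w]>)%VS.
Proof.
move=> wU /memv_addP[u uU [_ /vlineP[b ->] wE]]; have b0 : b != 0.
  by apply: contraNneq wU => b0; rewrite wE b0 scale0r addr0.
have -> : v = b^-1 *: (w - u) by rewrite wE addrC addKr scalerK.
by rewrite memvZ // addrC memv_add ?memvN ?memv_line.
Qed.

Lemma dim1_line U : \dim U = 1%N -> exists2 u, u != 0 & U = <[u]>%VS.
Proof.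
move=> dU; have u0 : vpick U != 0 by rewrite vpick0 -dimv_eq0 dU.
exists (vpick U) => //; apply/esym/eqP.
by rewrite eqEdim -memvE memv_pick dU dim_vline u0.
Qed.

Lemma dim2_span U : \dim U = 2%N ->
  exists u v, [/\ U = (<[u]> + <[v]>)%VS, u != 0 & v \notin <[u]>%VS].
Proof.
move=> dU; have u0 : vpick U != 0 by rewrite vpick0 -dimv_eq0 dU.
have [v vU vu] : exists2 v, v \in U & v \notin <[vpick U]>%VS.
  by apply: dim_lt_notin; rewrite dU dim_vline u0.
by exists (vpick U), v; split=> //; apply: span2_eq; rewrite ?memv_pick ?dU.
Qed.

Lemma dim3_span U : \dim U = 3%N -> exists u v w,
  [/\ U = (<[u]> + <[v]> + <[w]>)%VS, u != 0, v \notin <[u]>%VS &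
      w \notin (<[u]> + <[v]>)%VS].
Proof.
move=> dU; have u0 : vpick U != 0 by rewrite vpick0 -dimv_eq0 dU.
have [v vU vu] : exists2 v, v \in U & v \notin <[vpick U]>%VS.
  by apply: dim_lt_notin; rewrite dU dim_vline u0.
have [w wU wuv] : exists2 w, w \in U & w \notin (<[vpick U]> + <[v]>)%VS.
  by apply: dim_lt_notin; rewrite dU dim_span2.
by exists (vpick U), v, w; split=> //; apply: span3_eq; rewrite ?memv_pick ?dU.
Qed.

(** Subspaces are taken as predicates, so that kernels of functionals given as
    plain functions need not be packaged as vector spaces. *)
Definition lin_closed (Q : pred V) :=
  forall a u v, Q u -> Q v -> Q (a *: u + v).

Definition avoidable U (Q : pred V) :=
  lin_closed Q /\ exists2 u, u \in U & ~~ Q u.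

Lemma lin_closed_mem U : lin_closed (mem U).
Proof. by move=> a u v /= uU vU; rewrite memvD ?memvZ. Qed.

(** A vector space is not the union of at most [n] proper subspaces over a field
    with at least [n] elements. *)
Lemma avoid U (Qs : seq (pred V)) (s : seq F) :
  uniq s -> (size Qs <= size s)%N ->
  foldr (fun Q P => avoidable U Q /\ P) True Qs ->
  exists2 v, v \in U & all (fun Q : pred V => ~~ Q v) Qs.
Proof.
move=> s_uniq; elim: Qs => [|Q Qs IH] /=; first by exists 0; rewrite ?mem0v.
move=> ltQs [[Qlin [u uU Qu]] Qs_av].
have [v vU vQs] := IH (ltnW ltQs) Qs_av.
have [Qv|Qv] := boolP (Q v); last by exists v; rewrite ?Qv.
(* One of the vectors u + t v works: none of them is in Q, and each of the
   remaining subspaces, not containing v, contains at most one of them. *)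
have [all_bad|] := boolP (all (fun t => has (fun Q : pred V => Q (t *: v + u)) Qs) s).
  pose idx t := find (fun Q : pred V => Q (t *: v + u)) Qs.
  have idx_inj : {in s &, injective idx}.
    move=> t t' ts t's eq_idx; apply: contraTeq isT => tt'.
    have Qt := nth_find xpred0 (allP all_bad t ts).
    have Qt' := nth_find xpred0 (allP all_bad t' t's).
    have lt_t : (idx t < size Qs)%N by rewrite -has_find (allP all_bad).
    rewrite -/(idx t') -eq_idx /= in Qt'.
    have Wlin : lin_closed (nth xpred0 Qs (idx t)).
      elim: (Qs) (idx t) lt_t Qs_av => // R Rs IHs [|i] /= lti [[]] // _ _.
      exact: IHs.
    have /negP[] := (all_nthP xpred0 vQs) _ lt_t; rewrite -/(idx t) in Qt.
    have Qd : nth xpred0 Qs (idx t) ((t - t') *: v).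
      have := Wlin (-1) _ _ Qt' Qt.
      by rewrite scaleN1r opprD addrACA addNr addr0 addrC -scalerBl.
    have Q0 : nth xpred0 Qs (idx t) 0.
      by have := Wlin (-1) _ _ Qd Qd; rewrite scaleN1r addNr.
    have := Wlin (t - t')^-1 _ _ Qd Q0.
    by rewrite addr0 scalerK // subr_eq0.
  have sub : {subset [seq idx t | t <- s] <= iota 0 (size Qs)}.
    move=> _ /mapP[t ts ->]; rewrite mem_iota /= add0n -has_find.
    exact: (allP all_bad).
  have := uniq_leq_size _ sub; rewrite map_inj_in_uniq // => /(_ s_uniq).
  by rewrite size_map size_iota leqNgt ltQs.
case/allPn=> t ts tQs; exists (t *: v + u); first by rewrite memvD ?memvZ.
rewrite /= -all_predC in tQs.
apply/andP; split=> //.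
apply: contra Qu => Qtvu.
have := Qlin (- t) _ _ Qv Qtvu.
by rewrite addrA -scalerDl addNr scale0r add0r.
Qed.

End Spans.

(** * Relations given by formulas *)

Lemma tuple1E (T : Type) (t : 1.-tuple T) : exists x, t = [tuple x].
Proof. by case/tupleP: t => x t; exists x; rewrite (tuple0 t); apply: val_inj. Qed.

Lemma tuple2E (T : Type) (t : 2.-tuple T) : exists x y, t = [tuple x; y].
Proof.
case/tupleP: t => x t; have [y ->] := tuple1E t; exists x, y; exact: val_inj.
Qed.

Section Definability.

Variables (F : fieldType) (V : vectType F) (M : incidence_structure V).
Local Notation E := (element M).

Definition first_order k (P : k.-tuple E -> Prop) : Prop :=
  exists f : formula k, forall e, holds f e <-> P e.

(** Environments are tuples, and the operands of a relation are functions of the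
    environment that read off one of its entries.  Stating every closure lemma
    for arbitrary such functions makes renaming of variables unnecessary. *)
Definition variable_of k (c : k.-tuple E -> E) : Prop :=
  exists i, forall e, c e = tnth e i.

(** Under nested quantifiers the outer environment is an iterated tail of the
    current one. *)
Definition select k j (g : k.-tuple E -> j.-tuple E) : Prop :=
  exists s : 'I_j -> 'I_k, forall e i, tnth (g e) i = tnth e (s i).

Definition env_tail k (e : k.+1.-tuple E) : k.-tuple E := [tuple of behead e].

Lemma select_env_tail k : select (@env_tail k).
Proof. by exists (fun i => inord i.+1) => e i; rewrite tnth_behead. Qed.

Lemma select_tail k j (g : k.-tuple E -> j.+1.-tuple E) :
  select g -> select (fun e => env_tail (g e)).
Proof.
by case=> s gE; exists (fun i => s (inord i.+1)) => e i; rewrite tnth_behead gE.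
Qed.

Lemma variable_select k j (c : j.-tuple E -> E) (g : k.-tuple E -> j.-tuple E) :
  variable_of c -> select g -> variable_of (fun e => c (g e)).
Proof. by case=> i cE [s gE]; exists (s i) => e; rewrite cE gE. Qed.

Lemma variable_head k : variable_of (fun e : k.+1.-tuple E => thead e).
Proof. by exists ord0. Qed.

Lemma variable_nth k i : variable_of (fun e : k.-tuple E => tnth e i).
Proof. by exists i. Qed.

Lemma fo_not k (P : k.-tuple E -> Prop) :
  first_order P -> first_order (fun e => ~ P e).
Proof. by case=> f fP; exists (FNot f) => e /=; rewrite fP. Qed.

Lemma fo_and k (P Q : k.-tuple E -> Prop) :
  first_order P -> first_order Q -> first_order (fun e => P e /\ Q e).
Proof. by case=> f fP [g gQ]; exists (FAnd f g) => e /=; rewrite fP gQ. Qed.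

Lemma fo_equiv k (P Q : k.-tuple E -> Prop) :
  (forall e, P e <-> Q e) -> first_order P -> first_order Q.
Proof. by move=> PQ [f fP]; exists f => e; rewrite fP. Qed.

Lemma fo_and3 k (P Q R : k.-tuple E -> Prop) :
  first_order P -> first_order Q -> first_order R ->
  first_order (fun e => [/\ P e, Q e & R e]).
Proof.
move=> dP dQ dR; apply: fo_equiv (fo_and dP (fo_and dQ dR)) => e.
by split=> [[? []]|[]].
Qed.

Lemma fo_and4 k (P Q R S : k.-tuple E -> Prop) :
  first_order P -> first_order Q -> first_order R -> first_order S ->
  first_order (fun e => [/\ P e, Q e, R e & S e]).
Proof.
move=> dP dQ dR dS; apply: fo_equiv (fo_and dP (fo_and3 dQ dR dS)) => e.
by split=> [[? []]|[]].
Qed.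

Lemma fo_or k (P Q : k.-tuple E -> Prop) :
  first_order P -> first_order Q -> first_order (fun e => P e \/ Q e).
Proof.
move=> dP dQ; apply: fo_equiv (fo_not (fo_and (fo_not dP) (fo_not dQ))) => e.
by split; [tauto | case=> ? []].
Qed.

Lemma fo_imp k (P Q : k.-tuple E -> Prop) :
  first_order P -> first_order Q -> first_order (fun e => P e -> Q e).
Proof.
move=> dP dQ; apply: fo_equiv (fo_not (fo_and dP (fo_not dQ))) => e.
by split; [tauto | move=> PQ [/PQ]].
Qed.

Lemma fo_iff k (P Q : k.-tuple E -> Prop) :
  first_order P -> first_order Q -> first_order (fun e => P e <-> Q e).
Proof. by move=> dP dQ; apply: fo_and; apply: fo_imp. Qed.

Lemma fo_ex k (P : k.-tuple E -> E -> Prop) :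
  first_order (fun e : k.+1.-tuple E => P (env_tail e) (thead e)) ->
  first_order (fun e => exists x, P e x).
Proof.
case=> f fP; exists (FEx f) => e /=.
have tlE x : env_tail [tuple of x :: e] = e by apply: val_inj.
by split=> [] [x]; rewrite ?fP => Px; exists x; move: Px; rewrite ?fP tlE theadE.
Qed.

Lemma fo_all k (P : k.-tuple E -> E -> Prop) :
  first_order (fun e : k.+1.-tuple E => P (env_tail e) (thead e)) ->
  first_order (fun e => forall x, P e x).
Proof.
move=> dP; have dN := fo_not (fo_ex (P := fun e x => ~ P e x) (fo_not dP)).
apply: fo_equiv dN => e; split=> [no x|all [x []]] //.
by apply: NNPP => Px; apply: no; exists x.
Qed.

Lemma fo_eq k (a b : k.-tuple E -> E) :
  variable_of a -> variable_of b -> first_order (fun e => a e = b e).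
Proof. by case=> i aE [j bE]; exists (FEq i j) => e /=; rewrite aE bE. Qed.

Lemma fo_sort k s (a : k.-tuple E -> E) :
  variable_of a -> first_order (fun e => has_sort M s (val (a e))).
Proof. by case=> i aE; exists (FSort s i) => e /=; rewrite aE. Qed.

Lemma fo_inc k (a b : k.-tuple E -> E) : variable_of a -> variable_of b ->
  first_order (fun e => [/\ points M (val (a e)), lines M (val (b e)) &
                    (val (a e) <= val (b e))%VS]).
Proof. by case=> i aE [j bE]; exists (FInc i j) => e /=; rewrite aE bE. Qed.

End Definability.

Section Empty.

Variables (F : fieldType) (V : vectType F) (N M : incidence_structure V).

Lemma definable_empty : (forall s U, ~~ has_sort N s U) -> definable_in_terms_of N M.
Proof.
move=> N0; have absurd (t : 1.-tuple (element M)) :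
  ~ holds (FNot (FEq ord0 ord0)) t by case.
exists (fun=> 1%N), (fun=> FNot (FEq ord0 ord0)), (fun=> FEq ord0 ord0), (fun _ _ => 0%VS).
split=> [s t /absurd//|s U|s t t' /absurd//||s]; first by rewrite (negPf (N0 s U)).
  by exists (FEq ord0 ord0) => t t' /absurd.
by exists (FEq ord0 ord0), (FEq ord0 ord0) => t m /absurd.
Qed.

End Empty.

(** * First-order relations between the regular lines and planes *)

Section Relations.

Variables (F : fieldType) (V : vectType F) (M : incidence_structure V).
Implicit Types (a b c d m : element M) (A B C : element M).

(** The points of the structure are lines of the projective space, and its lines
    are planes; the names below are those of projective geometry. *)
Definition proj_line m : Prop := points M (val m).

Definition proj_plane A : Prop := lines M (val A).

Definition inc m A : Prop := [/\ proj_line m, proj_plane A & (val m <= val A)%VS].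

Definition coplanar a b : Prop := a <> b /\ exists A, inc a A /\ inc b A.

(** Three pairwise coplanar lines are concurrent or coplanar; the last clause
    excludes the second case. *)
Definition concurrent a b c : Prop :=
  [/\ coplanar a b, coplanar a c, coplanar b c &
      ~ exists A, [/\ inc a A, inc b A & inc c A]].

(** The point [a :&: b] lies on [m].  The auxiliary lines [c] and [d] pass
    through it and are in general position with [m], which itself may lie in the
    plane of [a] and [b]. *)
Definition through a b m : Prop :=
  coplanar a b /\ exists c d,
    [/\ concurrent a b c, concurrent a b d & concurrent c d m].

(** The point [a :&: b] lies in [A] and differs from the radical of [A]. *)
Definition visible a b A : Prop := exists m, through a b m /\ inc m A.

Definition joined a b a' b' : Prop := exists m, through a b m /\ through a' b' m.

Definition same_point a b a' b' : Prop := through a b a' /\ through a b b'.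

(** The point [a :&: b] is the radical of [A].  The clause on [joined] excludes
    the points outside [A] in dimension four, the clause on planes [B] excludes
    them in higher dimension. *)
Definition radical_at a b A : Prop :=
  [/\ coplanar a b, proj_plane A, ~ visible a b A &
    forall a' b', visible a' b' A -> ~ joined a b a' b' /\
      forall B, visible a b B -> visible a' b' B ->
        exists c d, [/\ ~ same_point a' b' c d, visible c d A & visible c d B]].

Definition radical_on A m : Prop :=
  exists a b, radical_at a b A /\ through a b m.

(** Among the radicals of the planes of the geometry, only the point [beta] can
    fail to be on a line of the geometry. *)
Definition represents A : Prop := exists m, radical_on A m.

Definition same_radical A B : Prop := forall m, radical_on A m <-> radical_on B m.

(** A plane contains no line of the geometry through its own radical, hence the
    first disjunct. *)
Definition radical_in A B : Prop :=
  proj_plane B /\ (same_radical A B \/ exists m, radical_on A m /\ inc m B).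

Definition on_common_line A B : Prop := exists m, radical_on A m /\ radical_on B m.

Definition on_common_plane A B : Prop := exists C, radical_in A C /\ radical_in B C.

(** Radicals that are joined by no line of the geometry are either orthogonal,
    and then in a common regular plane, or on a line through [beta], and then in
    no regular plane. *)
Definition represents_line A B : Prop :=
  [/\ represents A, represents B, ~ same_radical A B &
      on_common_line A B \/ ~ on_common_plane A B].

(** The last disjunct is for the lines through [beta]. *)
Definition radical_on_line A B C : Prop :=
  (same_radical C A \/ same_radical C B) \/
  (exists m, [/\ radical_on A m, radical_on B m & radical_on C m]) \/
  (~ on_common_plane A B /\ ~ on_common_plane A C).

End Relations.

(** The goals [first_order (fun e => R (a e) (b e))] are solved by following the
    syntax of [R]; the relations already treated are hints. *)
Create HintDb definability.

Ltac solve_variable :=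
  solve [ assumption | apply: variable_head | apply: variable_nth
        | eapply variable_select;
          [ solve_variable
          | repeat first [apply: select_env_tail | apply: select_tail] ] ].

Ltac solve_first_order := repeat first
  [ solve [ auto with nocore definability ]
  | apply: fo_eq; solve_variable
  | apply: fo_inc; solve_variable
  | apply: (fo_sort Point); solve_variable
  | apply: (fo_sort Line); solve_variable
  | apply: fo_and4 | apply: fo_and3 | apply: fo_iff | apply: fo_and
  | apply: fo_or | apply: fo_not | apply: fo_ex | apply: fo_all
  | apply: fo_imp ].

#[local] Hint Extern 0 (variable_of _) => solve_variable : definability.

Section DefinableRelations.

Variables (F : fieldType) (V : vectType F) (M : incidence_structure V).
Local Notation var k := (k.-tuple (element M) -> element M).

Lemma fo_coplanar k (a b : var k) : variable_of a -> variable_of b ->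
  first_order (fun e => coplanar (a e) (b e)).
Proof. by move=> *; rewrite /coplanar; solve_first_order. Qed.
#[local] Hint Resolve fo_coplanar : definability.

Lemma fo_concurrent k (a b c : var k) :
  variable_of a -> variable_of b -> variable_of c ->
  first_order (fun e => concurrent (a e) (b e) (c e)).
Proof. by move=> *; rewrite /concurrent; solve_first_order. Qed.
#[local] Hint Resolve fo_concurrent : definability.

Lemma fo_through k (a b m : var k) :
  variable_of a -> variable_of b -> variable_of m ->
  first_order (fun e => through (a e) (b e) (m e)).
Proof. by move=> *; rewrite /through; solve_first_order. Qed.
#[local] Hint Resolve fo_through : definability.

Lemma fo_visible k (a b A : var k) :
  variable_of a -> variable_of b -> variable_of A ->
  first_order (fun e => visible (a e) (b e) (A e)).
Proof. by move=> *; rewrite /visible; solve_first_order. Qed.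
#[local] Hint Resolve fo_visible : definability.

Lemma fo_radical_at k (a b A : var k) :
  variable_of a -> variable_of b -> variable_of A ->
  first_order (fun e => radical_at (a e) (b e) (A e)).
Proof. by move=> *; rewrite /radical_at /joined /same_point; solve_first_order. Qed.
#[local] Hint Resolve fo_radical_at : definability.

Lemma fo_radical_on k (A m : var k) : variable_of A -> variable_of m ->
  first_order (fun e => radical_on (A e) (m e)).
Proof. by move=> *; rewrite /radical_on; solve_first_order. Qed.
#[local] Hint Resolve fo_radical_on : definability.

Lemma fo_same_radical k (A B : var k) : variable_of A -> variable_of B ->
  first_order (fun e => same_radical (A e) (B e)).
Proof. by move=> *; rewrite /same_radical; solve_first_order. Qed.
#[local] Hint Resolve fo_same_radical : definability.

Lemma fo_represents k (A : var k) : variable_of A ->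
  first_order (fun e => represents (A e)).
Proof. by move=> *; rewrite /represents; solve_first_order. Qed.
#[local] Hint Resolve fo_represents : definability.

Lemma fo_radical_in k (A B : var k) : variable_of A -> variable_of B ->
  first_order (fun e => radical_in (A e) (B e)).
Proof. by move=> *; rewrite /radical_in; solve_first_order. Qed.
#[local] Hint Resolve fo_radical_in : definability.

Lemma fo_represents_line k (A B : var k) : variable_of A -> variable_of B ->
  first_order (fun e => represents_line (A e) (B e)).
Proof.
by move=> *; rewrite /represents_line /on_common_line /on_common_plane;
  solve_first_order.
Qed.

Lemma fo_radical_on_line k (A B C : var k) :
  variable_of A -> variable_of B -> variable_of C ->
  first_order (fun e => radical_on_line (A e) (B e) (C e)).
Proof. by move=> *; rewrite /radical_on_line /on_common_plane; solve_first_order. Qed.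

End DefinableRelations.

(** * The alternating form and the linear form *)

Section Geometry.

Variables (F : fieldType) (V : vectType F).
Variables (lam : V -> F) (eta : V -> V -> F) (beta : V).

(** In the application [eta u v + lam u * lam v] is the symmetric form, [beta]
    represents [lam] for it, and the kernel of [lam] is the hyperplane of
    selfconjugate points.  If [lam beta = 0], then [eta] is nondegenerate and
    [beta] is the radical of its restriction to the kernel; if [lam beta = 1],
    then [beta] is the radical of [eta]. *)
Hypothesis lam_lin : forall a u v, lam (a *: u + v) = a * lam u + lam v.
Hypothesis eta_lin : forall w a u v, eta w (a *: u + v) = a * eta w u + eta w v.
Hypothesis eta_anti : forall u v, eta u v = - eta v u.
Hypothesis eta_alt : forall u, eta u u = 0.
Hypothesis beta_neq0 : beta != 0.
Hypothesis lam_beta : lam beta = 0 \/ lam beta = 1.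
Hypothesis eta_beta : forall v, eta beta v = lam v * (1 - lam beta).
Hypothesis lam_neq0 : exists v, lam v != 0.
Hypothesis eta_rad :
  forall w, (forall v, eta w v = 0) -> w \in <[beta]>%VS.
Hypothesis eta_rad_ker : forall w, lam w = 0 ->
  (forall v, lam v = 0 -> eta w v = 0) -> w \in <[beta]>%VS.
Hypothesis dim_ge4 : (4 <= \dim {:V})%N.
Variable scalars : seq F.
Hypothesis scalars_uniq : uniq scalars.
Hypothesis size_scalars : size scalars = 8%N.

Implicit Types (p q r u v w x y z : V) (U W : {vspace V}).

Lemma lam0 : lam 0 = 0.
Proof. by have := lam_lin (-1) 0 0; rewrite scaleN1r oppr0 addr0 mulN1r addNr. Qed.

Lemma lamZ a u : lam (a *: u) = a * lam u.
Proof. by have := lam_lin a u 0; rewrite lam0 !addr0. Qed.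

Lemma lamD u v : lam (u + v) = lam u + lam v.
Proof. by have := lam_lin 1 u v; rewrite scale1r mul1r. Qed.

Lemma lamN u : lam (- u) = - lam u.
Proof. by rewrite -scaleN1r lamZ mulN1r. Qed.

Lemma eta0r u : eta u 0 = 0.
Proof. by have := eta_lin u (-1) 0 0; rewrite scaleN1r oppr0 addr0 mulN1r addNr. Qed.

Lemma etaZr w a u : eta w (a *: u) = a * eta w u.
Proof. by have := eta_lin w a u 0; rewrite eta0r !addr0. Qed.

Lemma etaDr w u v : eta w (u + v) = eta w u + eta w v.
Proof. by have := eta_lin w 1 u v; rewrite scale1r mul1r. Qed.

Lemma etaNr w u : eta w (- u) = - eta w u.
Proof. by rewrite -scaleN1r etaZr mulN1r. Qed.

Lemma eta0l u : eta 0 u = 0.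
Proof. by rewrite eta_anti eta0r oppr0. Qed.

Lemma etaZl w a u : eta (a *: u) w = a * eta u w.
Proof. by rewrite eta_anti etaZr -mulrN -eta_anti. Qed.

Lemma etaDl w u v : eta (u + v) w = eta u w + eta v w.
Proof. by rewrite eta_anti etaDr opprD -!eta_anti. Qed.

Lemma etaNl w u : eta (- u) w = - eta u w.
Proof. by rewrite -scaleN1r etaZl mulN1r. Qed.

Definition bilinE := (lamN, lamD, lamZ, lam0,
  etaNr, etaNl, etaDr, etaDl, etaZr, etaZl, eta_alt, eta0l, eta0r).

(** The exterior product of [lam] and [eta]. *)
Definition om p y z := lam p * eta y z - lam y * eta p z + lam z * eta p y.

Lemma om_linr p y a u v : om p y (a *: u + v) = a * om p y u + om p y v.
Proof. rewrite /om !bilinE; ring. Qed.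

Lemma om_swap p y z : om p z y = - om p y z.
Proof. rewrite /om (eta_anti z y); ring. Qed.

Lemma eta_span2 p y u v : eta u v = 0 -> p \in (<[u]> + <[v]>)%VS ->
  y \in (<[u]> + <[v]>)%VS -> eta p y = 0.
Proof.
move=> uv0 /mem_span2[a [b ->]] /mem_span2[c [d ->]].
by rewrite !bilinE (eta_anti v u) uv0; ring.
Qed.

Lemma om_span3 p y z u v w : om u v w = 0 -> p \in (<[u]> + <[v]> + <[w]>)%VS ->
  y \in (<[u]> + <[v]> + <[w]>)%VS -> z \in (<[u]> + <[v]> + <[w]>)%VS ->
  om p y z = 0.
Proof.
move=> o0 /mem_span3[a1 [b1 [c1 ->]]] /mem_span3[a2 [b2 [c2 ->]]].
case/mem_span3=> a3 [b3 [c3 ->]].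
pose d := a1 * (b2 * c3 - b3 * c2) - a2 * (b1 * c3 - b3 * c1)
          + a3 * (b1 * c2 - b2 * c1).
rewrite -[RHS](mulr0 d) -o0 /d /om !bilinE.
rewrite (eta_anti v u) (eta_anti w u) (eta_anti w v); ring.
Qed.

Lemma om_notin p y z : om p y z != 0 -> z \notin (<[p]> + <[y]>)%VS.
Proof.
apply: contra => /mem_span2[a [b ->]].
by rewrite /om !bilinE (eta_anti y p); apply/eqP; ring.
Qed.

Lemma eta_neq0_nz p y : eta p y != 0 -> p != 0.
Proof. by apply: contraNneq => ->; rewrite bilinE. Qed.

Lemma eta_neq0_notin p y : eta p y != 0 -> y \notin <[p]>%VS.
Proof. by apply: contra => /vlineP[k ->]; rewrite !bilinE mulr0. Qed.

Lemma om_neq0_nz p y z : om p y z != 0 -> p != 0.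
Proof. by apply: contraNneq => ->; rewrite /om !bilinE; apply/eqP; ring. Qed.

Lemma om_neq0_notin p y z : om p y z != 0 -> y \notin <[p]>%VS.
Proof.
by apply: contra => /vlineP[k ->]; rewrite /om !bilinE; apply/eqP; ring.
Qed.

(** * Nondegenerate subspaces *)

(** Nondegeneracy of the restriction to [U] of the symmetric form
    [eta u v + lam u * lam v]. *)
Definition nondegenerate_on U : Prop := forall w, w \in U ->
  (forall v, v \in U -> eta w v + lam w * lam v = 0) -> w = 0.

(** Since [eta] is alternating, a radical vector [w] has [lam w ^+ 2 = 0]. *)
Lemma radical_lam U w : w \in U ->
  (forall v, v \in U -> eta w v + lam w * lam v = 0) ->
  lam w = 0 /\ forall v, v \in U -> eta w v = 0.
Proof.
move=> wU w_rad; have lw : lam w = 0.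
  by have /eqP := w_rad w wU; rewrite eta_alt add0r mulf_eq0 orbb => /eqP.
by split=> // v vU; have := w_rad v vU; rewrite lw mul0r addr0.
Qed.

Lemma nondegenerate_point p : p != 0 ->
  nondegenerate_on <[p]>%VS <-> lam p != 0.
Proof.
move=> p0; split=> [nd|lp w].
  apply: contra p0 => /eqP lp; apply/eqP/nd; first exact: memv_line.
  by move=> v /vlineP[k ->]; rewrite !bilinE lp !mulr0 add0r.
move=> wU /(radical_lam wU)[+ _]; case/vlineP: wU => k ->.
by rewrite lamZ => /eqP; rewrite mulf_eq0 (negPf lp) orbF => /eqP->; rewrite scale0r.
Qed.

(** The vector [lam y p - lam p y] is in the radical of [eta] on [U] and in the
    kernel of [lam], so it is in the radical of the symmetric form.  Hence it is
    zero, and [p] and [y] are in the kernel of [lam] and in the radical too. *)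
Lemma nondegenerate_isotropic U p y : nondegenerate_on U -> p \in U -> y \in U ->
  p != 0 -> y \notin <[p]>%VS -> (forall v, v \in U -> eta p v = 0) ->
  (forall v, v \in U -> eta y v = 0) -> False.
Proof.
move=> nd pU yU p0 yp p_rad y_rad.
have h0 : lam y *: p - lam p *: y = 0.
  apply: nd; first by rewrite memvB ?memvZ.
  by move=> v vU; rewrite !bilinE p_rad ?y_rad //; ring.
have lp : lam p = 0.
  apply/eqP; apply: contraNT yp => lp.
  by rewrite -[y](scalerK lp) -(subr0_eq h0) !memvZ ?memv_line.
case/eqP: p0; apply: nd => // v vU.
by rewrite p_rad // lp mul0r addr0.
Qed.

(** If [eta p y = 0], then [eta] vanishes on the line and
    [nondegenerate_isotropic] applies. *)
Lemma nondegenerate_line p y : p != 0 -> y \notin <[p]>%VS ->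
  nondegenerate_on (<[p]> + <[y]>)%VS <-> eta p y != 0.
Proof.
move=> p0 yp; split=> [nd|py w wU /(radical_lam wU)[_ w_rad]].
  apply/eqP => py; apply: (nondegenerate_isotropic nd _ _ p0 yp) => [||v|v];
    rewrite ?mem_span2l ?mem_span2r // => /mem_span2[a [b ->]].
    by rewrite !bilinE py; ring.
  by rewrite !bilinE (eta_anti y p) py; ring.
have := w_rad p (mem_span2l _ _); have := w_rad y (mem_span2r _ _).
case/mem_span2: wU => a [b ->]; rewrite !bilinE (eta_anti y p) !mulr0 addr0 add0r.
move=> /eqP + /eqP; rewrite mulrN oppr_eq0 !mulf_eq0 (negPf py) !orbF.
by move=> /eqP-> /eqP->; rewrite !scale0r addr0.
Qed.

(** The radical of [eta] on [<p, y, z>] contains the vector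
    [eta y z p - eta p z y + eta p y z], at which [lam] has the value
    [om p y z]. *)
Lemma nondegenerate_plane p y z : p != 0 -> y \notin <[p]>%VS ->
  z \notin (<[p]> + <[y]>)%VS ->
  nondegenerate_on (<[p]> + <[y]> + <[z]>)%VS <-> om p y z != 0.
Proof.
move=> p0 yp zpy; split=> [nd|o w wU /(radical_lam wU)[lw w_rad]]; last first.
  have wp := w_rad p (mem_span3l _ _ _); have wy := w_rad y (mem_span3m _ _ _).
  have wz := w_rad z (mem_span3r _ _ _).
  case/mem_span3: wU => a [b [c wE]].
  (* Replacing one argument of [om] by the radical vector [w] gives 0, and
     isolates one coordinate of [w]. *)
  have oa : a * om p y z = 0.
    rewrite -[RHS](_ : om w y z = 0); last by rewrite /om lw wy wz; ring.
    by rewrite wE /om !bilinE ?(eta_anti y p) ?(eta_anti z p) ?(eta_anti z y); ring.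
  have ob : b * om p y z = 0.
    rewrite -[RHS](_ : om p w z = 0); last by rewrite /om (eta_anti p w) lw wp wz; ring.
    by rewrite wE /om !bilinE ?(eta_anti y p) ?(eta_anti z p) ?(eta_anti z y); ring.
  have oc : c * om p y z = 0.
    rewrite -[RHS](_ : om p y w = 0); last first.
      by rewrite /om (eta_anti p w) (eta_anti y w) lw wp wy; ring.
    by rewrite wE /om !bilinE ?(eta_anti y p) ?(eta_anti z p) ?(eta_anti z y); ring.
  move: oa ob oc => /eqP + /eqP + /eqP; rewrite !mulf_eq0 (negPf o) !orbF wE.
  by move=> /eqP-> /eqP-> /eqP->; rewrite !scale0r !addr0.
apply/eqP => o0.
have r0 : eta y z *: p - eta p z *: y + eta p y *: z = 0.
  apply: nd; first by rewrite memvD ?memvB ?memvZ ?mem_span3l ?mem_span3m ?mem_span3r.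
  have lr0 : lam (eta y z *: p - eta p z *: y + eta p y *: z) = 0.
    by rewrite -[RHS]o0 /om !bilinE; ring.
  move=> v /mem_span3[a [b [c ->]]]; rewrite lr0 !bilinE.
  by rewrite (eta_anti y p) (eta_anti z p) (eta_anti z y); ring.
have py : eta p y = 0.
  apply/eqP; apply: contraNT zpy => py; rewrite -[z](scalerK py) memvZ //.
  have -> : eta p y *: z = eta p z *: y - eta y z *: p.
    by apply/eqP; rewrite -subr_eq0 opprB addrC r0.
  by rewrite memvB ?memvZ ?mem_span2l ?mem_span2r.
move: r0; rewrite py scale0r addr0 => /subr0_eq r0.
have pz : eta p z = 0.
  apply/eqP; apply: contraNT yp => pz.
  by rewrite -[y](scalerK pz) -r0 !memvZ ?memv_line.
have yz : eta y z = 0.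
  move: r0; rewrite pz scale0r => /eqP.
  by rewrite scaler_eq0 (negPf p0) orbF => /eqP.
apply: (nondegenerate_isotropic nd _ _ p0 yp) => [||v|v];
  rewrite ?mem_span3l ?mem_span3m // => /mem_span3[a [b [c ->]]].
  by rewrite !bilinE py pz; ring.
by rewrite !bilinE (eta_anti y p) py yz; ring.
Qed.

(** If [lam beta] is 1, then [beta] is in the radical of [eta], but [eta] is
    nondegenerate on the line. *)
Lemma eta_beta_span p y : eta p y != 0 -> beta \in (<[p]> + <[y]>)%VS ->
  lam beta = 0.
Proof.
case: lam_beta => // lb1 pyN0 bpy; have eb v : eta beta v = 0.
  by rewrite eta_beta lb1 subrr mulr0.
case/mem_span2: bpy => a [b bE]; have := eb y; have := eb p.
rewrite bE !bilinE (eta_anti y p) => /eqP + /eqP.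
rewrite !(add0r, addr0, mulr0, mulrN, oppr_eq0, mulf_eq0) (negPf pyN0) !orbF.
move=> /eqP b0 /eqP a0; case/eqP: beta_neq0.
by rewrite bE a0 b0 !scale0r addr0.
Qed.

(** On the kernel of [lam], the functional [om p y] coincides with
    [eta (lam p y - lam y p)], and the radical of [eta] on this kernel is
    spanned by [beta] or zero. *)
Lemma om_exists p y : lam p *: y - lam y *: p \notin <[beta]>%VS ->
  exists z, om p y z != 0.
Proof.
set h := (X in X \notin _) => hb; apply: NNPP => no_z.
have om0 z : om p y z = 0.
  by apply/eqP/negP => /negP o; apply: no_z; exists z.
case/negP: hb; apply: eta_rad_ker => [|v lv0].
  by rewrite /h !bilinE; ring.
by have := om0 v; rewrite /om lv0 /h !bilinE => <-; ring.
Qed.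

(** Every line of the geometry is in a regular plane, since [beta] is not on
    it. *)
Lemma om_exists_line p y : eta p y != 0 -> beta \notin (<[p]> + <[y]>)%VS ->
  exists z, om p y z != 0.
Proof.
move=> py bpy.
have [/andP[/eqP lp0 /eqP ly0]|lN0] := boolP ((lam p == 0) && (lam y == 0)).
  have [z lz] := lam_neq0; exists z.
  by rewrite /om lp0 ly0 !mul0r subr0 add0r mulf_neq0.
apply: om_exists; apply: contra bpy => hb.
have h_span : lam p *: y - lam y *: p \in (<[p]> + <[y]>)%VS.
  by rewrite memvB ?memvZ ?mem_span2l ?mem_span2r.
apply: vline_trans h_span; apply: vline_sym hb.
apply: contra lN0; rewrite subr_eq0 => /eqP hE.
have lp0 : lam p = 0.
  apply/eqP; apply: contraNT (eta_neq0_notin py) => lp.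
  by rewrite -[y](scalerK lp) hE !memvZ ?memv_line.
rewrite lp0 eqxx /=; move: hE; rewrite lp0 scale0r => /esym/eqP.
by rewrite scaler_eq0 (negPf (eta_neq0_nz py)) orbF.
Qed.

(** For [p] not in [<beta>] and [y] outside this subspace with [eta p y]
    nonzero, the line [<p, y>] neither lies in the kernel of [lam] nor passes
    through [beta], so it is a line of both structures considered. *)
Definition special p : pred V :=
  fun y => if lam p == 0 then lam y == 0 else y \in (<[p]> + <[beta]>)%VS.

Lemma special_lin p : lin_closed (special p).
Proof.
move=> a u v; rewrite /special; case: ifP => _; last exact: lin_closed_mem.
by rewrite lam_lin => /eqP-> /eqP->; rewrite mulr0 addr0.
Qed.

Lemma ker_eta_lin p : lin_closed (fun y => eta p y == 0).
Proof. by move=> a u v /eqP u0 /eqP v0; rewrite eta_lin u0 v0 mulr0 addr0. Qed.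

Lemma ker_om_lin p y : lin_closed (fun z => om p y z == 0).
Proof. by move=> a u v /eqP u0 /eqP v0; rewrite om_linr u0 v0 mulr0 addr0. Qed.

Lemma ker_lam_lin : lin_closed (fun y => lam y == 0).
Proof. by move=> a u v /eqP u0 /eqP v0; rewrite lam_lin u0 v0 mulr0 addr0. Qed.

Lemma special_beta p y : p \notin <[beta]>%VS -> eta p y != 0 -> ~~ special p y ->
  beta \notin (<[p]> + <[y]>)%VS.
Proof.
move=> pb py; apply: contra => bpy; have lb0 := eta_beta_span py bpy.
have bp : beta \notin <[p]>%VS by apply: contra pb; apply: vline_sym.
rewrite /special (mem_add_swap bp bpy); case: ifP => // /eqP lp0.
case/mem_span2: bpy => a [b bE]; move/eqP: lb0.
rewrite bE !bilinE lp0 mulr0 add0r mulf_eq0 => /orP[/eqP b0|//].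
by case/negP: bp; rewrite bE b0 scale0r addr0 memvZ ?memv_line.
Qed.

Lemma avoid8 U (Qs : seq (pred V)) : (size Qs <= 8)%N ->
  foldr (fun Q P => avoidable U Q /\ P) True Qs ->
  exists2 v, v \in U & all (fun Q : pred V => ~~ Q v) Qs.
Proof. by move=> le8; apply: avoid scalars_uniq _; rewrite size_scalars. Qed.

Lemma small_avoidable U W : (\dim W < \dim U)%N -> avoidable U (fun w => w \in W).
Proof. by move=> d; split; [apply: lin_closed_mem | apply: dim_lt_notin]. Qed.

Lemma span2_avoidable u v : avoidable {:V} (fun w => w \in <[u]> + <[v]>)%VS.
Proof.
by apply: small_avoidable; apply: leq_ltn_trans (dim_span2_le _ _) _; apply: ltnW.
Qed.

Lemma span3_avoidable u v w : avoidable {:V} (fun x => x \in <[u]> + <[v]> + <[w]>)%VS.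
Proof. by apply: small_avoidable; apply: leq_ltn_trans (dim_span3_le _ _ _) _. Qed.

Lemma ker_eta_avoidable p :
  p \notin <[beta]>%VS -> avoidable {:V} (fun y => eta p y == 0).
Proof.
move=> pb; split; first exact: ker_eta_lin.
apply: NNPP => no; case/negP: pb; apply: eta_rad => v.
by apply/eqP; apply: NNPP => /negP pv; apply: no; exists v; rewrite ?memvf.
Qed.

Lemma ker_om_avoidable p y : eta p y != 0 -> beta \notin (<[p]> + <[y]>)%VS ->
  avoidable {:V} (fun z => om p y z == 0).
Proof.
move=> py bpy; split; first exact: ker_om_lin.
by have [z oz] := om_exists_line py bpy; exists z; rewrite ?memvf.
Qed.

Lemma special_avoidable p : avoidable {:V} (special p).
Proof.
split; first exact: special_lin.
have [lp|lp] := boolP (lam p == 0).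
  by have [v lv] := lam_neq0; exists v; rewrite ?memvf // /special lp.
have [_ [v _ vN]] := span2_avoidable p beta.
by exists v; rewrite ?memvf // /special (negPf lp).
Qed.

(** * Lines and planes of the geometry *)

(** The structure B2 corresponds to [off_kernel = false], and C2, whose points
    are not contained in the hyperplane, to [off_kernel = true]. *)
Variable M : incidence_structure V.
Variable off_kernel : bool.
Hypothesis pointsP : forall U, points M U <-> exists p y,
  [/\ U = (<[p]> + <[y]>)%VS, eta p y != 0, beta \notin U &
      off_kernel -> exists2 u, u \in U & lam u != 0].
Hypothesis linesP : forall U, lines M U <-> exists p y z,
  U = (<[p]> + <[y]> + <[z]>)%VS /\ om p y z != 0.

Implicit Types (a b c d m : element M) (A B : element M).

Lemma proj_line_dim m : proj_line m -> \dim (val m) = 2%N.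
Proof.
by case/pointsP=> p [y [-> py _ _]]; rewrite dim_span2 ?eta_neq0_notin ?(eta_neq0_nz py).
Qed.

Lemma proj_plane_dim A : proj_plane A -> \dim (val A) = 3%N.
Proof.
case/linesP=> p [y [z [-> o]]].
by rewrite dim_add_line ?om_notin // dim_span2 ?(om_neq0_nz o) ?(om_neq0_notin o).
Qed.

(** [eta] on a line is determined up to a factor by its value at any basis. *)
Lemma proj_line_eta m u v : proj_line m -> u \in val m -> v \in val m -> u != 0 ->
  v \notin <[u]>%VS -> val m = (<[u]> + <[v]>)%VS /\ eta u v != 0.
Proof.
move=> mp um vm u0 vu; have mE : val m = (<[u]> + <[v]>)%VS.
  by apply: span2_eq => //; rewrite proj_line_dim.
split=> //; case/pointsP: mp => p [y [mE' py _ _]].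
apply: contra py => /eqP uv0; apply/eqP.
by apply: eta_span2 uv0 _ _; rewrite -mE mE' ?mem_span2l ?mem_span2r.
Qed.

Lemma proj_plane_om A p y z : proj_plane A -> p \in val A -> y \in val A -> z \in val A ->
  p != 0 -> y \notin <[p]>%VS -> z \notin (<[p]> + <[y]>)%VS ->
  val A = (<[p]> + <[y]> + <[z]>)%VS /\ om p y z != 0.
Proof.
move=> Al pA yA zA p0 yp zpy; have AE : val A = (<[p]> + <[y]> + <[z]>)%VS.
  by apply: span3_eq => //; rewrite proj_plane_dim.
split=> //; case/linesP: Al => u [v [w [AE' o]]].
apply: contra o => /eqP o0; apply/eqP.
by apply: om_span3 o0 _ _ _; rewrite -AE AE' ?mem_span3l ?mem_span3m ?mem_span3r.
Qed.

Lemma proj_line_beta m : proj_line m -> beta \notin val m.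
Proof. by case/pointsP=> p [y []]. Qed.

Lemma proj_line_complete m p : proj_line m -> p \in val m -> p != 0 ->
  exists y, val m = (<[p]> + <[y]>)%VS /\ eta p y != 0.
Proof.
move=> mp pm p0; have [] := @dim_lt_notin _ _ (val m) <[p]>%VS.
  by rewrite proj_line_dim // dim_vline p0.
by move=> y ym yp; exists y; apply: proj_line_eta.
Qed.

Lemma proj_line_vec m p : proj_line m -> p \in val m -> p != 0 -> p \notin <[beta]>%VS.
Proof.
move=> mp pm p0; apply: contra (proj_line_beta mp) => pb.
exact: vline_trans (vline_sym p0 pb) pm.
Qed.

Lemma make_line_span p y : eta p y != 0 -> beta \notin (<[p]> + <[y]>)%VS ->
  lam p != 0 \/ lam y != 0 ->
  exists m, proj_line m /\ val m = (<[p]> + <[y]>)%VS.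
Proof.
move=> py bpy lpy; have mp : points M (<[p]> + <[y]>)%VS.
  apply/pointsP; exists p, y; split=> // _.
  by case: lpy => l; [exists p | exists y]; rewrite ?mem_span2l ?mem_span2r.
have mlp : points M (<[p]> + <[y]>)%VS || lines M (<[p]> + <[y]>)%VS by rewrite mp.
by exists (exist _ (<[p]> + <[y]>)%VS mlp).
Qed.

Lemma make_line p y : p \notin <[beta]>%VS -> eta p y != 0 -> ~~ special p y ->
  exists m, proj_line m /\ val m = (<[p]> + <[y]>)%VS.
Proof.
move=> pb py spy; apply: make_line_span => //; first exact: special_beta.
move: spy; rewrite /special; case: ifP => [_ ly|/negbT lp _]; [by right|by left].
Qed.

Lemma make_plane p y z : om p y z != 0 ->
  exists A, proj_plane A /\ val A = (<[p]> + <[y]> + <[z]>)%VS.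
Proof.
move=> o; set U := (<[p]> + _ + _)%VS; have Al : lines M U.
  by apply/linesP; exists p, y, z.
have Alp : points M U || lines M U by rewrite Al orbT.
by exists (exist _ U Alp).
Qed.

(** * Pencils of concurrent lines *)

Definition meet_at a b p : Prop :=
  [/\ p != 0, coplanar a b & (val a :&: val b = <[p]>)%VS].

Lemma coplanar_meet a b : coplanar a b -> exists p, meet_at a b p.
Proof.
move=> ab; have [nab [A [[ap Al aA] [bp _ bA]]]] := ab.
have le3 : (\dim (val a + val b) <= 3)%N.
  by rewrite -(proj_plane_dim Al) dimvS // subv_add aA bA.
have cap_a : (\dim (val a :&: val b) < 2)%N.
  rewrite ltn_neqAle -{2}(proj_line_dim ap) dimvS ?capvSl // andbT.
  apply/eqP => d2; apply: nab; apply: val_inj => /=.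
  apply: etrans (_ : (val a :&: val b)%VS = _).
    by apply/esym/eqP; rewrite eqEdim capvSl d2 proj_line_dim.
  by apply/eqP; rewrite eqEdim capvSr d2 proj_line_dim.
have d1 : \dim (val a :&: val b) = 1%N.
  have := dimv_sum_cap (val a) (val b); rewrite !proj_line_dim //.
  by move: cap_a le3; do 2!case: (\dim _) => [|[|[|[|?]]]].
exists (vpick (val a :&: val b)); split=> //.
  by rewrite vpick0 -dimv_eq0 d1.
apply/esym/eqP; rewrite eqEdim -memvE memv_pick d1 dim_vline.
by rewrite vpick0 -dimv_eq0 d1.
Qed.

Lemma meet_mem a b p : meet_at a b p -> p \in val a /\ p \in val b.
Proof. by case=> _ _ ab; apply/memv_capP; rewrite ab memv_line. Qed.

Lemma coplanar_lines a b : coplanar a b -> proj_line a /\ proj_line b.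
Proof. by case=> _ [A [[? _ _] [? _ _]]]. Qed.

(** If [c] met [a] and [b] in distinct points, it would be spanned by them and
    thus lie in the plane of [a] and [b]. *)
Lemma concurrent_meet a b c p :
  concurrent a b c -> meet_at a b p -> p \in val c.
Proof.
case=> ab ac bc nabc abp.
have [q acq] := coplanar_meet ac; have [r bcr] := coplanar_meet bc.
have [qa qc] := meet_mem acq; have [rb rc] := meet_mem bcr.
have [q0 _ _] := acq; have [r0 _ _] := bcr; have [_ _ capab] := abp.
have [cp bp] : proj_line c /\ proj_line b by case: (coplanar_lines bc).
have [rq|rq] := boolP (r \in <[q]>%VS).
  have : q \in (val a :&: val b)%VS.
    by rewrite memv_cap qa (vline_trans (vline_sym r0 rq)).
  rewrite capab => qp; apply: vline_trans (vline_sym q0 qp) qc.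
case: nabc; have [_ [A [aA bA]]] := ab; exists A; split=> //.
have [_ Al subA] := aA; have [_ _ subB] := bA; split=> //.
have [-> _] := proj_line_eta cp qc rc q0 rq.
by apply: sub_span2; [apply: (subvP subA) | apply: (subvP subB)].
Qed.

Lemma coplanar_om a b p y z : proj_line a -> proj_line b ->
  val a = (<[p]> + <[y]>)%VS -> val b = (<[p]> + <[z]>)%VS ->
  om p y z != 0 -> coplanar a b.
Proof.
move=> ap bp aE bE o; split.
  by move=> ab; have := om_notin o; rewrite -aE ab bE mem_span2r.
have [A [Al AE]] := make_plane o; exists A; rewrite /inc AE aE bE.
by split; split=> //; rewrite ?addvSl // sub_span2 ?mem_span3l ?mem_span3r.
Qed.

Lemma meet_om a b p y z : meet_at a b p ->
  val a = (<[p]> + <[y]>)%VS -> val b = (<[p]> + <[z]>)%VS -> om p y z != 0.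
Proof.
move=> [p0 [nab [A [[ap Al aA] [bp _ bA]]]] cap] aE bE.
have yp : y \notin <[p]>%VS.
  apply: contraTN isT => yp; have := proj_line_dim ap.
  by rewrite aE (addv_idPl _) // -?memvE // dim_vline p0.
have zpy : z \notin (<[p]> + <[y]>)%VS.
  apply/negP => z_in; apply: nab; apply: val_inj => /=.
  by apply/esym/eqP; rewrite eqEdim !proj_line_dim // aE bE sub_span2 ?mem_span2l.
have [] // := @proj_plane_om A p y z Al.
- by apply: (subvP aA); rewrite aE mem_span2l.
- by apply: (subvP aA); rewrite aE mem_span2r.
- by apply: (subvP bA); rewrite bE mem_span2r.
Qed.

Lemma meet_coplanar_om a b p y z : proj_line a -> proj_line b ->
  val a = (<[p]> + <[y]>)%VS -> val b = (<[p]> + <[z]>)%VS ->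
  om p y z != 0 -> meet_at a b p.
Proof.
move=> ap bp aE bE o; have ab := coplanar_om ap bp aE bE o.
have [q abq] := coplanar_meet ab; have [q0 _ cap] := abq.
split=> //; first exact: om_neq0_nz o.
rewrite cap; apply/esym; apply: vline_eq; first exact: om_neq0_nz o.
by rewrite -cap memv_cap aE bE !mem_span2l.
Qed.

Lemma concurrent_om a b c p y z w : proj_line a -> proj_line b -> proj_line c ->
  val a = (<[p]> + <[y]>)%VS -> val b = (<[p]> + <[z]>)%VS ->
  val c = (<[p]> + <[w]>)%VS -> om p y z != 0 -> om p y w != 0 ->
  om p z w != 0 -> w \notin (<[p]> + <[y]> + <[z]>)%VS -> concurrent a b c.
Proof.
move=> ap bp cp aE bE cE oyz oyw ozw wN; split; try exact: coplanar_om.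
  exact: (coplanar_om ap bp aE bE).
  exact: (coplanar_om ap cp aE cE).
  exact: (coplanar_om bp cp bE cE).
case=> A [[_ Al aA] [_ _ bA] [_ _ cA]].
have [] := @proj_plane_om A p y z Al.
- by apply: (subvP aA); rewrite aE mem_span2l.
- by apply: (subvP aA); rewrite aE mem_span2r.
- by apply: (subvP bA); rewrite bE mem_span2r.
- exact: om_neq0_nz oyz.
- exact: om_neq0_notin oyz.
- exact: om_notin.
by move=> AE _; case/negP: wN; rewrite -AE (subvP cA) // cE mem_span2r.
Qed.

(** For soundness, [c] and [d] pass through [a :&: b], and [m] passes through
    [c :&: d].  For completeness, [c] is a line through [p] in general position
    with [a], [b], [m], and [d] is one in general position with [a], [b], [m]
    and [c]. *)
Lemma throughP a b m p : meet_at a b p ->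
  through a b m <-> proj_line m /\ p \in val m.
Proof.
move=> abp; split.
  case=> _ [c [d [abc abd cdm]]].
  have [cd_cop cm _ _] := cdm; have [_ mp] := coplanar_lines cm; split=> //.
  have [q cdq] := coplanar_meet cd_cop.
  have [p0 _ _] := abp; have [_ _ capcd] := cdq.
  have pq : p \in <[q]>%VS.
    by rewrite -capcd memv_cap (concurrent_meet abc abp) (concurrent_meet abd abp).
  exact: vline_trans pq (concurrent_meet cdm cdq).
case=> mp pm; have [p0 ab _] := abp; split=> //.
have [pa pb] := meet_mem abp; have [ap bp] := coplanar_lines ab.
have pbeta := proj_line_vec mp pm p0.
have [y [mE py]] := proj_line_complete mp pm p0.
have [y1 [aE py1]] := proj_line_complete ap pa p0.
have [y2 [bE py2]] := proj_line_complete bp pb p0.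
have o12 := meet_om abp aE bE.
have om_av (n : element M) z : proj_line n -> val n = (<[p]> + <[z]>)%VS -> eta p z != 0 ->
    avoidable {:V} (fun w => om p z w == 0).
  by move=> np nE pz; apply: ker_om_avoidable => //; rewrite -nE proj_line_beta.
have av_y := om_av _ _ mp mE py; have av_y1 := om_av _ _ ap aE py1.
have av_y2 := om_av _ _ bp bE py2.
have av_p := ker_eta_avoidable pbeta; have av_s := special_avoidable p.
have av_12 := span3_avoidable p y1 y2.
have [] := @avoid8 fullv [:: fun w => eta p w == 0; special p;
    fun w => om p y1 w == 0; fun w => om p y2 w == 0; fun w => om p y w == 0;
    fun w => (w \in <[p]> + <[y1]> + <[y2]>)%VS] isT.
  by do ![split=> //].
move=> y3 _ /= /and5P[py3 sy3 o13 o23 /and3P[oy3 n3 _]].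
have [c [cp cE]] := make_line pbeta py3 sy3.
have av_y3 := om_av _ _ cp cE py3.
have av_3 := span3_avoidable p y3 y.
(* The eight subspaces avoided here are the reason for the bound on the number
   of scalars. *)
have [] := @avoid8 fullv [:: fun w => eta p w == 0; special p;
    fun w => om p y1 w == 0; fun w => om p y2 w == 0; fun w => om p y w == 0;
    fun w => om p y3 w == 0; fun w => (w \in <[p]> + <[y1]> + <[y2]>)%VS;
    fun w => (w \in <[p]> + <[y3]> + <[y]>)%VS] isT.
  by do ![split=> //].
move=> y4 _ /= /and5P[py4 sy4 o14 o24 /and5P[oy4 o34 n4 n4' _]].
have [d [dp dE]] := make_line pbeta py4 sy4.
exists c, d; split.
- exact: (concurrent_om ap bp cp aE bE cE).
- exact: (concurrent_om ap bp dp aE bE dE).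
have oNy x : om p y x != 0 -> om p x y != 0 by rewrite (om_swap p x) oppr_eq0.
apply: (concurrent_om cp dp mp cE dE mE o34 (oNy _ oy3) (oNy _ oy4)).
by apply: contra n4'; apply: mem_add_swap (om_notin (oNy _ oy3)).
Qed.

Lemma meet_exists m p : proj_line m -> p \in val m -> p != 0 ->
  exists b, meet_at m b p.
Proof.
move=> mp pm p0; have pbeta := proj_line_vec mp pm p0.
have [y [mE py]] := proj_line_complete mp pm p0.
have av_p := ker_eta_avoidable pbeta; have av_s := special_avoidable p.
have av_y : avoidable {:V} (fun w => om p y w == 0).
  by apply: ker_om_avoidable => //; rewrite -mE proj_line_beta.
have [] := @avoid8 fullv [:: fun w => eta p w == 0; special p;
    fun w => om p y w == 0] isT.
  by do ![split=> //].
move=> z _ /= /and4P[pz sz oz _]; have [b [bp bE]] := make_line pbeta pz sz.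
by exists b; apply: meet_coplanar_om bE oz.
Qed.

(** * The radical of a regular plane *)

(** The standard formula for the radical of an alternating form on a
    three-dimensional space, in terms of a basis. *)
Definition rad_vec A : V :=
  let e := vbasis (val A) in
  eta e`_1 e`_2 *: e`_0 - eta e`_0 e`_2 *: e`_1 + eta e`_0 e`_1 *: e`_2.

Lemma rad_vecP A : proj_plane A ->
  [/\ rad_vec A \in val A, lam (rad_vec A) != 0 &
      forall v, v \in val A -> eta (rad_vec A) v = 0].
Proof.
move=> Al; rewrite /rad_vec; set e := vbasis (val A).
have : size e = 3%N by rewrite size_tuple (proj_plane_dim Al).
have : <<e>>%VS = val A by apply: span_basis; apply: vbasisP.
case: {+}(tval e) => [|x [|y [|z []]]] // eE _.
have AE : val A = (<[x]> + <[y]> + <[z]>)%VS.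
  by rewrite -eE !span_cons span_nil addv0 addvA.
have o : om x y z != 0.
  have [u [v [w [AE' o]]]] := (linesP _).1 Al.
  apply: contra o => /eqP o0; apply/eqP.
  by apply: om_span3 o0 _ _ _; rewrite -AE AE' ?mem_span3l ?mem_span3m ?mem_span3r.
rewrite AE /=; split.
- by rewrite memvD ?memvB ?memvZ ?mem_span3l ?mem_span3m ?mem_span3r.
- by apply: contra o => /eqP o0; apply/eqP; rewrite -[RHS]o0 /om !bilinE; ring.
move=> v /mem_span3[a [b [c ->]]]; rewrite !bilinE.
by rewrite (eta_anti y x) (eta_anti z x) (eta_anti z y); ring.
Qed.

Lemma rad_vec_neq0 A : proj_plane A -> rad_vec A != 0.
Proof. by case/rad_vecP=> _ l _; apply: contraNneq l => ->; rewrite lam0. Qed.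

(** A vector [p] of the radical independent of [rad_vec A] would make [om]
    vanish on [A]. *)
Lemma rad_vec_unique A p : proj_plane A -> p \in val A ->
  (forall v, v \in val A -> eta p v = 0) -> p \in <[rad_vec A]>%VS.
Proof.
move=> Al pA p_rad; have [rA lr r_rad] := rad_vecP Al.
apply: contraT => pr; have r0 := rad_vec_neq0 Al.
have [w wA wrp] : exists2 w, w \in val A & w \notin (<[rad_vec A]> + <[p]>)%VS.
  by apply: dim_lt_notin; rewrite (proj_plane_dim Al) ltnS dim_span2_le.
have [_] := proj_plane_om Al rA pA wA r0 pr wrp.
by rewrite /om (p_rad w wA) (r_rad w wA) (r_rad p pA) !mulr0 subr0 addr0 eqxx.
Qed.

(** If [beta] is on a line of [A] on which [eta] is nonzero, then
    [lam beta = 0], so [eta beta] is [lam], which does not vanish at the radical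
    of [A]. *)
Lemma plane_beta A p v : proj_plane A -> p \in val A -> v \in val A ->
  eta p v != 0 -> beta \notin (<[p]> + <[v]>)%VS.
Proof.
move=> Al pA vA pv; apply/negP => bpv; have lb0 := eta_beta_span pv bpv.
have [_ lr r_rad] := rad_vecP Al; case/negP: lr.
have := r_rad beta (subvP (sub_span2 pA vA) _ bpv).
by rewrite eta_anti eta_beta lb0 subr0 mulr1 => /eqP; rewrite oppr_eq0.
Qed.

(** The line [<p, v>] may lie in the kernel of [lam]; adding the radical of [A]
    to [v] then gives a line that does not. *)
Lemma plane_line A p v : proj_plane A -> p \in val A -> v \in val A ->
  eta p v != 0 -> exists m, inc m A /\ p \in val m.
Proof.
move=> Al pA vA pv; have [rA lr r_rad] := rad_vecP Al.
have [w [wA pw l]] : exists w,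
    [/\ w \in val A, eta p w != 0 & lam p != 0 \/ lam w != 0].
  have [lp|lp] := boolP (lam p == 0); last by exists v; split=> //; left.
  have [lv|lv] := boolP (lam v == 0); last by exists v; split=> //; right.
  exists (v + rad_vec A); rewrite memvD // etaDr (eta_anti p (rad_vec A)).
  rewrite r_rad // oppr0 addr0.
  by rewrite lamD (eqP lv) add0r; split=> //; right.
have [m [mp mE]] := make_line_span pw (plane_beta Al pA wA pw) l.
by exists m; rewrite /inc mE mem_span2l sub_span2.
Qed.

Lemma visible_meet a b A : visible a b A -> proj_plane A /\ exists p, meet_at a b p.
Proof. by case=> m [[ab _] [_ Al _]]; split=> //; apply: coplanar_meet. Qed.

(** The lines of the geometry in [A] are those that do not contain the radical
    of [A], up to the one in the kernel of [lam] when it is excluded. *)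
Lemma visibleP a b A p : meet_at a b p -> proj_plane A ->
  visible a b A <-> p \in val A /\ exists2 v, v \in val A & eta p v != 0.
Proof.
move=> abp Al; split.
  case=> m [/(throughP _ abp)[mp pm] [_ _ mA]]; have [p0 _ _] := abp.
  have [y [mE py]] := proj_line_complete mp pm p0.
  by split; [|exists y => //]; apply: (subvP mA); rewrite // mE mem_span2r.
case=> pA [v vA pv]; have [m [mA pm]] := plane_line Al pA vA pv.
by exists m; split=> //; apply/(throughP _ abp); case: mA.
Qed.

Lemma visible_at A p v : proj_plane A -> p \in val A -> v \in val A ->
  eta p v != 0 -> exists a b, meet_at a b p.
Proof.
move=> Al pA vA pv; have [m [[mp _ _] pm]] := plane_line Al pA vA pv.
have [b ab] := meet_exists mp pm (eta_neq0_nz pv); by exists m, b.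
Qed.

Lemma scalar_avoid (T : seq F) : (size T < 8)%N -> exists t, t \notin T.
Proof.
move=> lt8; apply: NNPP => no; have /(uniq_leq_size scalars_uniq) : {subset scalars <= T}.
  by move=> t _; apply: contraT => tT; case: no; exists t.
by rewrite size_scalars leqNgt lt8.
Qed.

Lemma meet_beta a b p : meet_at a b p -> p \notin <[beta]>%VS.
Proof.
move=> abp; have [p0 ab _] := abp; have [pa _] := meet_mem abp.
by case: (coplanar_lines ab) => ap _; apply: proj_line_vec pa p0.
Qed.

(** A line of the geometry joining [p] to a visible point [q] of [A] would be
    one on which [eta] is nonzero, but [eta p q = 0].  A plane [B] through [p]
    and [q] shares with [A] the whole line [p q]. *)
Lemma radical_at_rad a b A p : meet_at a b p -> proj_plane A -> p \in val A ->
  (forall v, v \in val A -> eta p v = 0) -> radical_at a b A.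
Proof.
move=> abp Al pA p_rad; have [p0 ab _] := abp.
split=> //; first by case/(visibleP abp Al)=> _ [v vA]; rewrite p_rad ?eqxx.
move=> a' b' visq; have [_ [q abq]] := visible_meet visq.
have [qA [v vA qv]] := (visibleP abq Al).1 visq.
have pq : p \notin <[q]>%VS.
  apply/negP => /(vline_sym p0)/vlineP[k qE].
  by case/negP: qv; rewrite qE etaZl p_rad // mulr0.
split.
  case=> m [/(throughP _ abp)[mp pm] /(throughP _ abq)[_ qm]].
  have [q0 _ _] := abq; have [_] := proj_line_eta mp qm pm q0 pq.
  by rewrite eta_anti p_rad // oppr0 eqxx.
move=> B visB visqB; have [Bl _] := visible_meet visB.
have [pB _] := (visibleP abp Bl).1 visB.
have [qB [w wB qw]] := (visibleP abq Bl).1 visqB.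
(* The points p + t q with t <> 0 of the common line p q are visible on A;
   they are visible on B for all t but at most one. *)
have [t] := @scalar_avoid [:: 0; - eta p w / eta q w] isT.
rewrite !inE negb_or => /andP[t0 tw].
pose s := p + t *: q.
have sv : eta s v != 0 by rewrite /s !bilinE p_rad // add0r mulf_neq0.
have sw : eta s w != 0.
  apply: contra tw; rewrite /s !bilinE addrC addr_eq0 => /eqP tE.
  by rewrite -tE mulfK.
have sA : s \in val A by rewrite memvD ?memvZ.
have sB : s \in val B by rewrite memvD ?memvZ.
have [c [d cds]] := visible_at Al sA vA sv; exists c, d; split.
- case=> /(throughP _ abq)[_ qc] /(throughP _ abq)[_ qd].
  have [q0 _ _] := abq; have [_ _ cds_cap] := cds.
  have : q \in <[s]>%VS by rewrite -cds_cap memv_cap qc.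
  move/(vline_sym q0)=> sq; case/negP: pq.
  by rewrite -[p](addrK (t *: q)) memvB // memvZ ?memv_line.
- by apply/(visibleP cds Al); split=> //; exists v.
- by apply/(visibleP cds Bl); split=> //; exists w.
Qed.

(** In dimension four, [A] and [p] span the space, so that [eta p] does not
    vanish on [A]; a generic point of [A] is then joined to [p]. *)
Lemma outside_joined a b A p : meet_at a b p -> proj_plane A -> p \notin val A ->
  \dim {:V} = 4%N -> exists a' b', visible a' b' A /\ joined a b a' b'.
Proof.
move=> abp Al pA dim4; have pbeta := meet_beta abp.
have [rA lr _] := rad_vecP Al.
have AE : (val A + <[p]>)%VS = fullv.
  by apply/eqP; rewrite eqEdim subvf dim_add_line // (proj_plane_dim Al) dim4.
have av_p : avoidable (val A) (fun y => eta p y == 0).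
  split; first exact: ker_eta_lin; have [_ [v _ pv]] := ker_eta_avoidable pbeta.
  have := memvf v; rewrite -AE => /memv_addP[u uA [_ /vlineP[k ->] vE]].
  by exists u; rewrite // vE !bilinE mulr0 addr0 in pv *.
have av_s : avoidable (val A) (special p).
  split; first exact: special_lin; have [lp|lp] := boolP (lam p == 0).
    by exists (rad_vec A); rewrite // /special lp.
  have [|v vA vN] := @dim_lt_notin _ _ (val A) (<[p]> + <[beta]>)%VS.
    by rewrite (proj_plane_dim Al) ltnS dim_span2_le.
  by exists v; rewrite // /special (negPf lp).
have av_r : avoidable (val A) (fun v => v \in <[rad_vec A]>%VS).
  by apply: small_avoidable; rewrite (proj_plane_dim Al) dim_vline; case: (_ != 0).
have [] := @avoid8 (val A) [:: fun w => eta p w == 0; special p;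
    fun v => v \in <[rad_vec A]>%VS] isT.
  by do ![split=> //].
move=> q qA /= /and4P[pq sq qr _].
have [v vA qv] : exists2 v, v \in val A & eta q v != 0.
  apply: NNPP => no; case/negP: qr; apply: rad_vec_unique => // v vA.
  by apply/eqP; apply: contraT => qv; case: no; exists v.
have [a' [b' abq]] := visible_at Al qA vA qv.
have [m [mp mE]] := make_line pbeta pq sq.
exists a', b'; split; first by apply/(visibleP abq Al); split=> //; exists v.
exists m; split; first by apply/(throughP _ abp); rewrite mE mem_span2l.
by apply/(throughP _ abq); rewrite mE mem_span2r.
Qed.

(** The plane [B] is spanned by [p], a generic point [q] of [A] and a generic
    vector [y]: as [A] and [p] span a proper subspace in dimension at least
    five, [y] can be taken outside it, and then [B] meets [A] in [q] only. *)
Lemma outside_meets_once a b A p : meet_at a b p -> proj_plane A -> p \notin val A ->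
  (4 < \dim {:V})%N -> exists a' b' B,
    [/\ visible a' b' A, visible a b B, visible a' b' B &
      forall c d, visible c d A -> visible c d B -> same_point a' b' c d].
Proof.
move=> abp Al pA dim5; have pbeta := meet_beta abp.
have [rA lr _] := rad_vecP Al.
have av_l : avoidable (val A) (fun v => lam v == 0).
  by split; [exact: ker_lam_lin | exists (rad_vec A)].
have av_b : avoidable (val A) (fun v => v \in (<[p]> + <[beta]>)%VS).
  by apply: small_avoidable; rewrite (proj_plane_dim Al) ltnS dim_span2_le.
have av_r : avoidable (val A) (fun v => v \in <[rad_vec A]>%VS).
  by apply: small_avoidable; rewrite (proj_plane_dim Al) dim_vline; case: (_ != 0).
have [] := @avoid8 (val A) [:: fun v => lam v == 0;
    fun v => v \in (<[p]> + <[beta]>)%VS; fun v => v \in <[rad_vec A]>%VS] isT.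
  by do ![split=> //].
move=> q qA /= /and4P[lq qb qr _].
have [v vA qv] : exists2 v, v \in val A & eta q v != 0.
  apply: NNPP => no; case/negP: qr; apply: rad_vec_unique => // v vA.
  by apply/eqP; apply: contraT => qv; case: no; exists v.
have [a' [b' abq]] := visible_at Al qA vA qv.
have av_o : avoidable {:V} (fun y => om p q y == 0).
  split; first exact: ker_om_lin.
  have [|z oz] := @om_exists p q; last by exists z; rewrite ?memvf.
  apply: contra qb => hb; rewrite addvC; apply: mem_add_swap => //.
  have -> : p = (lam q)^-1 *: (lam p *: q - (lam p *: q - lam q *: p)).
    by rewrite opprB addrC subrK scalerK.
  by rewrite memvZ // addrC memv_add ?memvN // memvZ ?memv_line.
have av_p := ker_eta_avoidable pbeta.
have av_q := ker_eta_avoidable (meet_beta abq).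
have av_A : avoidable {:V} (fun y => y \in (val A + <[p]>)%VS).
  by apply: small_avoidable; rewrite dim_add_line // (proj_plane_dim Al).
have [] := @avoid8 fullv [:: fun y => om p q y == 0; fun y => eta p y == 0;
    fun y => eta q y == 0; fun y => y \in (val A + <[p]>)%VS] isT.
  by do ![split=> //].
move=> y _ /= /and5P[o py qy yA _].
have [B [Bl BE]] := make_plane o; exists a', b', B; split.
- by apply/(visibleP abq Al); split=> //; exists v.
- apply/(visibleP abp Bl); rewrite BE mem_span3l; split=> //.
  by exists y; rewrite ?mem_span3r.
- apply/(visibleP abq Bl); rewrite BE mem_span3m; split=> //.
  by exists y; rewrite ?mem_span3r.
move=> c d visA visB; have [_ [s cds]] := visible_meet visA.
have [sA _] := (visibleP cds Al).1 visA; have [sB _] := (visibleP cds Bl).1 visB.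
have [s0 cd _] := cds; have [cp dp] := coplanar_lines cd.
have [sc sd] := meet_mem cds.
suff sq : q \in <[s]>%VS.
  by split; apply/(throughP _ abq); rewrite ?(vline_trans sq).
apply: vline_sym s0 _; move: sB; rewrite BE => /mem_span3[x [t [k sE]]].
have k0 : k = 0.
  apply/eqP; apply: contraNT yA => kN.
  have inA u : u \in val A -> u \in (val A + <[p]>)%VS by apply: (subvP (addvSl _ _)).
  have -> : y = k^-1 *: (s - (x *: p + t *: q)).
    by rewrite sE [_ + k *: y]addrC addrK scalerK.
  by rewrite memvZ // memvB ?memvD ?memvZ ?(inA q) ?(inA s) // memvE addvSr.
have x0 : x = 0.
  apply/eqP; apply: contraNT pA => xN.
  have -> : p = x^-1 *: (s - t *: q) by rewrite sE k0 scale0r addr0 addrK scalerK.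
  by rewrite memvZ ?memvB ?memvZ.
by rewrite sE k0 x0 !scale0r addr0 add0r memvZ ?memv_line.
Qed.

Lemma radical_atP a b A p : meet_at a b p ->
  radical_at a b A <-> proj_plane A /\ p \in <[rad_vec A]>%VS.
Proof.
move=> abp; split; last first.
  case=> Al pr; have [rA _ r_rad] := rad_vecP Al.
  apply: radical_at_rad abp Al (vline_trans pr rA) _ => v vA.
  by case/vlineP: pr => k ->; rewrite etaZl r_rad ?mulr0.
case=> ab Al novis rad; split=> //.
have [pA|pA] := boolP (p \in val A).
  apply: rad_vec_unique => // v vA; apply/eqP; apply: contraT => pv.
  by case: novis; apply/(visibleP abp Al); split=> //; exists v.
have [dim5|] := ltnP 4 (\dim {:V}).
  have [a' [b' [B [visq visB visqB same]]]] := outside_meets_once abp Al pA dim5.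
  have [_ /(_ B visB visqB)[c [d [ns visA' visB']]]] := rad _ _ visq.
  by case: ns; apply: same.
move=> dim_le; have dim4 : \dim {:V} = 4%N by apply/eqP; rewrite eqn_leq dim_le.
have [a' [b' [visq join]]] := outside_joined abp Al pA dim4.
by case: (rad _ _ visq).
Qed.

Lemma radical_onP A m :
  radical_on A m <-> [/\ proj_plane A, proj_line m & rad_vec A \in val m].
Proof.
split.
  case=> a [b [radA abm]]; have [ab _ _ _] := radA.
  have [p abp] := coplanar_meet ab; have [p0 _ _] := abp.
  have [Al pr] := (radical_atP _ abp).1 radA.
  have [mp pm] := (throughP _ abp).1 abm.
  by split=> //; apply: vline_trans (vline_sym p0 pr) pm.
case=> Al mp rm; have [b mbr] := meet_exists mp rm (rad_vec_neq0 Al).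
exists m, b; split; last exact/(throughP _ mbr).
by apply/(radical_atP _ mbr); rewrite memv_line.
Qed.

(** * Points off the kernel of [lam], represented by regular planes *)

Lemma representsP A :
  represents A <-> proj_plane A /\ rad_vec A \notin <[beta]>%VS.
Proof.
split.
  by case=> m /radical_onP[Al mp rm]; rewrite (proj_line_vec mp rm (rad_vec_neq0 Al)).
case=> Al rb; have av_r := ker_eta_avoidable rb; have av_s := special_avoidable (rad_vec A).
have [] := @avoid8 fullv [:: fun w => eta (rad_vec A) w == 0; special (rad_vec A)] isT.
  by do ![split=> //].
move=> y _ /= /and3P[ry sy _]; have [m [mp mE]] := make_line rb ry sy.
by exists m; apply/radical_onP; rewrite mE mem_span2l.
Qed.

Lemma represents_lam A : represents A -> lam (rad_vec A) != 0.
Proof. by case/representsP=> Al _; case: (rad_vecP Al). Qed.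

Lemma represents_neq0 A : represents A -> rad_vec A != 0.
Proof. by case/representsP=> Al _; apply: rad_vec_neq0. Qed.

Lemma represents_radical_on A m : represents A ->
  radical_on A m <-> proj_line m /\ rad_vec A \in val m.
Proof.
case/representsP=> Al _; split; first by case/radical_onP.
by case=> mp rm; apply/radical_onP.
Qed.

(** If the radicals differ, a generic line through the first avoids the
    second. *)
Lemma same_radicalP A B : represents A -> represents B ->
  same_radical A B <-> rad_vec B \in <[rad_vec A]>%VS.
Proof.
move=> rA rB; split=> [same|BA m]; last first.
  have AB := vline_sym (represents_neq0 rB) BA.
  split=> /represents_radical_on[] // mp rm; apply/represents_radical_on => //.
    by split=> //; apply: vline_trans BA rm.
  by split=> //; apply: vline_trans AB rm.
have [_ rb] := (representsP A).1 rA.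
have av_r := ker_eta_avoidable rb; have av_s := special_avoidable (rad_vec A).
have av_B := span2_avoidable (rad_vec A) (rad_vec B).
have [] := @avoid8 fullv [:: fun w => eta (rad_vec A) w == 0; special (rad_vec A);
    fun w => w \in (<[rad_vec A]> + <[rad_vec B]>)%VS] isT.
  by do ![split=> //].
move=> y _ /= /and4P[ry sy yAB _]; have [m [mp mE]] := make_line rb ry sy.
have /same/represents_radical_on[//|_] : radical_on A m.
  by apply/represents_radical_on; rewrite // mE mem_span2l.
rewrite mE => B_in; apply: contraT => BA; case/negP: yAB.
exact: mem_add_swap BA B_in.
Qed.

Lemma same_radical_represents A B : represents A -> same_radical A B -> represents B.
Proof. by case=> m Am same; exists m; apply/same. Qed.

(** A point of [B] either is the radical of [B] or is visible in [B]. *)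
Lemma radical_inP A B : represents A ->
  radical_in A B <-> proj_plane B /\ rad_vec A \in val B.
Proof.
move=> rA; split=> [[Bl BA]|[Bl AB]]; split=> //.
  case: BA => [same|[m [/represents_radical_on[]// _ rm [_ _ mB]]]]; last exact: (subvP mB).
  have rB := same_radical_represents rA same; have [rBB _ _] := rad_vecP Bl.
  apply: vline_trans rBB; apply: vline_sym (represents_neq0 rB) _.
  exact/same_radicalP.
have [rad|] := classic (forall v, v \in val B -> eta (rad_vec A) v = 0).
  left; have AB' := rad_vec_unique Bl AB rad.
  have [_ rb] := (representsP A).1 rA.
  apply/same_radicalP => //; last exact: vline_sym (represents_neq0 rA) AB'.
  apply/representsP; split=> //; apply: contra rb => Bb; exact: vline_trans AB' Bb.
move=> nrad; right; have [v vB Av] : exists2 v, v \in val B & eta (rad_vec A) v != 0.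
  apply: NNPP => no; apply: nrad => v vB; apply/eqP; apply: contraT => Av.
  by case: no; exists v.
have [m [mB rm]] := plane_line Bl AB vB Av; exists m; split=> //.
by have [mp _ _] := mB; apply/represents_radical_on.
Qed.

Lemma on_common_planeP A B : represents A -> represents B ->
  on_common_plane A B <-> exists C : element M,
    [/\ proj_plane C, rad_vec A \in val C & rad_vec B \in val C].
Proof.
move=> rA rB; split=> [[C [/radical_inP[]// Cl AC /radical_inP[]// _ BC]]|[C [Cl AC BC]]].
  by exists C.
by exists C; split; apply/radical_inP.
Qed.

(** By [om_exists], if the line [p q] is in no regular plane, then
    [lam p q - lam q p] is a nonzero multiple of [beta].  If moreover
    [eta p q = 0], then [eta beta p = 0], so [lam beta = 1]; but the multiple is
    in the kernel of [lam]. *)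
Lemma om_zero_beta p q : lam p != 0 -> q \notin <[p]>%VS ->
  (forall z, om p q z = 0) ->
  beta \in (<[p]> + <[q]>)%VS /\ eta p q != 0.
Proof.
move=> lp qp om0.
have hb : lam p *: q - lam q *: p \in <[beta]>%VS.
  by apply: contraT => /om_exists[z]; rewrite om0 eqxx.
have h0 : lam p *: q - lam q *: p != 0.
  rewrite subr_eq0; apply: contra qp => /eqP hE.
  by rewrite -[q](scalerK lp) hE !memvZ ?memv_line.
split.
  by apply: vline_trans (vline_sym h0 hb) _; rewrite memvB ?memvZ ?mem_span2l ?mem_span2r.
apply: contra h0 => /eqP pq0; case/vlineP: hb => k hE.
have kb : k * lam beta = 0 by rewrite -lamZ -hE !bilinE; ring.
have : k * eta beta p = 0 by rewrite -etaZl -hE !bilinE (eta_anti q p) pq0; ring.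
rewrite eta_beta (_ : _ * _ = k * lam p - k * lam beta * lam p); last by ring.
rewrite kb mul0r subr0 => /eqP; rewrite mulf_eq0 (negPf lp) orbF => /eqP k0.
by rewrite hE k0 scale0r.
Qed.

Lemma not_on_common_plane A B : represents A -> represents B ->
  rad_vec B \notin <[rad_vec A]>%VS -> ~ on_common_plane A B ->
  beta \in (<[rad_vec A]> + <[rad_vec B]>)%VS /\ eta (rad_vec A) (rad_vec B) != 0.
Proof.
move=> rA rB BA noC; apply: om_zero_beta (represents_lam rA) BA _ => z.
apply/eqP; apply: contraT => o; case: noC; apply/on_common_planeP => //.
by have [C [Cl CE]] := make_plane o; exists C; rewrite CE mem_span3l mem_span3m.
Qed.

Lemma on_common_lineP A B : represents A -> represents B ->
  rad_vec B \notin <[rad_vec A]>%VS ->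
  on_common_line A B <-> eta (rad_vec A) (rad_vec B) != 0 /\
                   beta \notin (<[rad_vec A]> + <[rad_vec B]>)%VS.
Proof.
move=> rA rB BA; split.
  case=> m [/represents_radical_on[]// mp Am /represents_radical_on[]// _ Bm].
  have [mE AB] := proj_line_eta mp Am Bm (represents_neq0 rA) BA.
  by rewrite -mE proj_line_beta.
case=> AB bAB; have [|m [mp mE]] := make_line_span AB bAB.
  by left; apply: represents_lam.
by exists m; split; apply/represents_radical_on; rewrite // mE ?mem_span2l ?mem_span2r.
Qed.

Lemma represents_lineP A B : represents_line A B <->
  [/\ represents A, represents B & eta (rad_vec A) (rad_vec B) != 0].
Proof.
split=> [[rA rB nAB AB]|[rA rB AB]]; split=> //.
  have BA : rad_vec B \notin <[rad_vec A]>%VS.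
    by apply/negP => /(same_radicalP rA rB).
  case: AB => [/on_common_lineP[]//|]; by case/not_on_common_plane.
  by move/(same_radicalP rA rB); apply/negP; apply: eta_neq0_notin.
have BA := eta_neq0_notin AB.
have [bAB|bAB] := boolP (beta \in (<[rad_vec A]> + <[rad_vec B]>)%VS); last first.
  by left; apply/on_common_lineP.
right=> /on_common_planeP[]// C [Cl AC BC].
by have := plane_beta Cl AC BC AB; rewrite bAB.
Qed.

(** If neither [A], [B] nor [A], [C] have a regular plane in common, then both
    joining lines pass through [beta] and the first radical, so they are
    equal. *)
Lemma radical_on_lineP A B C : represents_line A B -> represents C ->
  radical_on_line A B C <-> rad_vec C \in (<[rad_vec A]> + <[rad_vec B]>)%VS.
Proof.
move=> /represents_lineP[rA rB AB] rC; have BA := eta_neq0_notin AB.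
split.
  case=> [[] same|[[m [Am Bm Cm]]|[nAB nAC]]].
  - apply: vline_trans (mem_span2l _ _).
    by apply: vline_sym (represents_neq0 rA) _; apply/same_radicalP.
  - apply: vline_trans (mem_span2r _ _).
    by apply: vline_sym (represents_neq0 rB) _; apply/same_radicalP.
  - move: Am Bm Cm => /represents_radical_on[]// mp Am.
    move=> /represents_radical_on[]// _ Bm /represents_radical_on[]// _ Cm.
    by have [<-] := proj_line_eta mp Am Bm (represents_neq0 rA) BA.
  have [CA|CA] := boolP (rad_vec C \in <[rad_vec A]>%VS).
    exact: vline_trans CA (mem_span2l _ _).
  have [bAB _] := not_on_common_plane rA rB BA nAB.
  have [bAC _] := not_on_common_plane rA rC CA nAC.
  have bA : beta \notin <[rad_vec A]>%VS.
    have [_] := (representsP A).1 rA; apply: contra; exact: vline_sym.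
  apply: (subvP (sub_span2 (mem_span2l _ _) bAB)).
  exact: mem_add_swap bA bAC.
move=> CAB; have [CA|CA] := boolP (rad_vec C \in <[rad_vec A]>%VS).
  left; left; apply/same_radicalP => //; exact: vline_sym (represents_neq0 rC) CA.
have ABE : (<[rad_vec A]> + <[rad_vec C]>)%VS = (<[rad_vec A]> + <[rad_vec B]>)%VS.
  apply/esym/span2_eq; rewrite ?dim_span2_le ?mem_span2l //.
  exact: represents_neq0.
right; have [bAB|bAB] := boolP (beta \in (<[rad_vec A]> + <[rad_vec B]>)%VS).
  right; split=> /on_common_planeP[]// D [Dl AD BD].
    by have := plane_beta Dl AD BD AB; rewrite bAB.
  have BD' : rad_vec B \in val D.
    by apply: (subvP (sub_span2 AD BD)); rewrite ABE mem_span2r.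
  by have := plane_beta Dl AD BD' AB; rewrite bAB.
left; have [|m [mp mE]] := make_line_span AB bAB.
  by left; apply: represents_lam.
by exists m; split; apply/represents_radical_on; rewrite // mE ?mem_span2l ?mem_span2r.
Qed.

(** The orthogonal complement of [p] contains a vector [x] outside [<p, beta>].
    No [x - k p] is then in the radical of [eta], so the complement contains [z]
    with [eta x z] nonzero, and [<p, x, z>] is regular with radical [p]. *)
Lemma represents_exists p : lam p != 0 -> p \notin <[beta]>%VS ->
  exists A, represents A /\ <[rad_vec A]>%VS = <[p]>%VS.
Proof.
move=> lp pb; have [_ [u0 _ pu0]] := ker_eta_avoidable pb.
have [u pu1] : exists u, eta p u = 1.
  by exists ((eta p u0)^-1 *: u0); rewrite etaZr mulVf.
have [_ [v _ vN]] := span3_avoidable p u beta.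
(* As [eta p u = 1], subtracting a multiple of [u] projects onto the orthogonal
   complement of [p]. *)
pose x := v - eta p v *: u.
have px : eta p x = 0 by rewrite /x !bilinE pu1 mulr1 subrr.
have xN : x - eta x u *: p \notin <[beta]>%VS.
  apply: contra vN => xb; set k := eta x u in xb.
  have -> : v = k *: p + eta p v *: u + (x - k *: p).
    by rewrite addrC addrA subrK /x subrK.
  by rewrite memv_add // memv_add ?memvZ ?memv_line.
clearbody x.
have [y xy] : exists y, eta (x - eta x u *: p) y != 0.
  apply: NNPP => no; case/negP: xN; apply: eta_rad => y.
  by apply/eqP; apply: contraT => xy; case: no; exists y.
pose z := y - eta p y *: u.
have pz : eta p z = 0 by rewrite /z !bilinE pu1 mulr1 subrr.
have xz : eta x z != 0.
  by move: xy; rewrite /z !bilinE [eta p y * _]mulrC.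
clearbody z.
have o : om p x z != 0 by rewrite /om px pz !mulr0 subr0 addr0 mulf_neq0.
have [A [Al AE]] := make_plane o.
have pr : p \in <[rad_vec A]>%VS.
  apply: rad_vec_unique; rewrite // AE ?mem_span3l // => w /mem_span3[a [b [c ->]]].
  by rewrite !bilinE px pz; ring.
have p0 := om_neq0_nz o.
exists A; split; last by apply/esym; apply: vline_eq.
by apply/representsP; split=> //; apply: contra pb; apply: vline_trans.
Qed.

(** The line [U] meets the kernel of [lam] in one point only, so it is spanned
    by two points off the kernel other than [beta]. *)
Lemma represents_line_exists U u v w : U = (<[u]> + <[v]>)%VS -> eta u v != 0 ->
  w \in U -> lam w != 0 ->
  exists A B, represents_line A B /\ (<[rad_vec A]> + <[rad_vec B]>)%VS = U.
Proof.
move=> UE uv wU lw; have dU : \dim U = 2%N.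
  by rewrite UE dim_span2 ?eta_neq0_notin ?(eta_neq0_nz uv).
have av_l : avoidable U (fun x => lam x == 0) by split; [exact: ker_lam_lin | exists w].
have av_line x : avoidable U (fun y => y \in <[x]>%VS).
  by apply: small_avoidable; rewrite dU dim_vline; case: (_ != 0).
have av_b := av_line beta.
have [] := @avoid8 U [:: fun x => lam x == 0; fun x => x \in <[beta]>%VS] isT.
  by do ![split=> //].
move=> p pU /= /and3P[lp pb _]; have av_p := av_line p.
have [] := @avoid8 U [:: fun x => lam x == 0; fun x => x \in <[beta]>%VS;
    fun x => x \in <[p]>%VS] isT.
  by do ![split=> //].
move=> q qU /= /and4P[lq qb qp _].
have [A [rA AE]] := represents_exists lp pb.
have [B [rB BE]] := represents_exists lq qb.
have p0 : p != 0 by apply: contraNneq lp => ->; rewrite lam0.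
have UE' : U = (<[p]> + <[q]>)%VS by apply: span2_eq; rewrite ?dU.
exists A, B; rewrite AE BE; split=> //; apply/represents_lineP; split=> //.
apply: contra uv => /eqP AB0; apply/eqP.
by apply: eta_span2 AB0 _ _; rewrite AE BE -UE' UE ?mem_span2l ?mem_span2r.
Qed.

(** * The interpretation *)

Variable N : incidence_structure V.
Hypothesis N_pointsP : forall U, points N U <-> exists p,
  [/\ U = <[p]>%VS, lam p != 0 & p \notin <[beta]>%VS].
Hypothesis N_linesP : forall U, lines N U <-> exists p y w,
  [/\ U = (<[p]> + <[y]>)%VS, eta p y != 0, w \in U & lam w != 0].

Definition code_length s : nat := match s with Point => 1 | Line => 2 end.

Definition decode s : (code_length s).-tuple (element M) -> {vspace V} :=
  match s with
  | Point => fun t => <[rad_vec (tnth t ord0)]>%VS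
  | Line => fun t => (<[rad_vec (tnth t ord0)]> + <[rad_vec (tnth t ord_max)]>)%VS
  end.

Lemma represents_line_lines A B : represents_line A B ->
  [/\ represents A, represents B & lines N (<[rad_vec A]> + <[rad_vec B]>)%VS].
Proof.
case/represents_lineP=> rA rB AB; split=> //; apply/N_linesP.
exists (rad_vec A), (rad_vec B), (rad_vec A); split=> //; first exact: mem_span2l.
exact: represents_lam.
Qed.

Lemma sub_radicalP A m : represents A ->
  radical_on A m \/ radical_in A m <-> (<[rad_vec A]> <= val m)%VS.
Proof.
move=> rA; rewrite -memvE; split=> [[/represents_radical_on[]//|/radical_inP[]//]|Am].
have /orP[mp|ml] := valP m; first by left; apply/represents_radical_on.
by right; apply/radical_inP.
Qed.

Lemma not_sub_radical A m : represents A -> ~~ (val m <= <[rad_vec A]>)%VS.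
Proof.
move=> rA; apply/negP => /dimvS; rewrite dim_vline.
have /orP[mp|ml] := valP m; [rewrite (proj_line_dim mp)|rewrite (proj_plane_dim ml)];
by case: (_ != 0).
Qed.

Lemma sub_decode_line A B m : represents_line A B ->
  radical_on A m /\ radical_on B m <->
  (val m <= <[rad_vec A]> + <[rad_vec B]>)%VS.
Proof.
case/represents_lineP=> rA rB AB; have BA := eta_neq0_notin AB.
split.
  case=> /represents_radical_on[]// mp Am /represents_radical_on[]// _ Bm.
  by have [<-] := proj_line_eta mp Am Bm (represents_neq0 rA) BA.
have /orP[mp|ml] := valP m; last first.
  move/dimvS; rewrite (proj_plane_dim ml) => d.
  by have := leq_trans d (dim_span2_le _ _).
move=> sub; have mE : val m = (<[rad_vec A]> + <[rad_vec B]>)%VS.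
  apply/eqP; rewrite eqEdim sub (proj_line_dim mp); exact: dim_span2_le.
by split; apply/represents_radical_on; rewrite // mE ?mem_span2l ?mem_span2r.
Qed.

Lemma interpretation : definable_in_terms_of N M.
Proof.
pose v k i lt_ik := @variable_nth _ _ M k (@Ordinal k i lt_ik).
have [f_point f_pointP] := fo_represents (v 1%N 0%N isT).
have [f_line f_lineP] := fo_represents_line (v 2%N 0%N isT) (v 2%N 1%N isT).
have [eq_point eq_pointP] := fo_same_radical (v 2%N 0%N isT) (v 2%N 1%N isT).
have [eq_line eq_lineP] := fo_and
  (fo_radical_on_line (v 4%N 0%N isT) (v 4%N 1%N isT) (v 4%N 2%N isT))
  (fo_radical_on_line (v 4%N 0%N isT) (v 4%N 1%N isT) (v 4%N 3%N isT)).
have [f_inc f_incP] :=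
  fo_radical_on_line (v 3%N 1%N isT) (v 3%N 2%N isT) (v 3%N 0%N isT).
have [below_point below_pointP] := fo_or
  (fo_radical_on (v 2%N 1%N isT) (v 2%N 0%N isT))
  (fo_radical_in (v 2%N 1%N isT) (v 2%N 0%N isT)).
have [above_point above_pointP] := fo_not (fo_eq (v 2%N 0%N isT) (v 2%N 0%N isT)).
have [below_line below_lineP] := fo_and
  (fo_or (fo_radical_on (v 3%N 1%N isT) (v 3%N 0%N isT))
          (fo_radical_in (v 3%N 1%N isT) (v 3%N 0%N isT)))
  (fo_or (fo_radical_on (v 3%N 2%N isT) (v 3%N 0%N isT))
          (fo_radical_in (v 3%N 2%N isT) (v 3%N 0%N isT))).
have [above_line above_lineP] := fo_and
  (fo_radical_on (v 3%N 1%N isT) (v 3%N 0%N isT))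
  (fo_radical_on (v 3%N 2%N isT) (v 3%N 0%N isT)).
exists code_length.
exists (fun s => match s return formula (code_length s) with
                 | Point => f_point | Line => f_line end).
exists (fun s => match s return formula (code_length s + code_length s) with
                 | Point => eq_point | Line => eq_line end).
exists decode; split.
- case=> [/tuple1E[A ->]|/tuple2E[A [B ->]]] /=.
  + move/f_pointP; rewrite (tnth_nth A) /= => rA; apply/N_pointsP.
    exists (rad_vec A); rewrite (represents_lam rA); split=> //.
    by case/representsP: rA.
  + by move/f_lineP; rewrite !(tnth_nth A) /= => /represents_line_lines[].
- case=> U.
  + case/N_pointsP=> p [UE lp pb]; have [A [rA AE]] := represents_exists lp pb.
    by exists [tuple A]; [apply/f_pointP | rewrite UE -AE].
  + case/N_linesP=> u [w [x [UE uw xU lx]]].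
    have [A [B [rAB ABE]]] := represents_line_exists UE uw xU lx.
    by exists [tuple A; B]; [apply/f_lineP | rewrite -ABE].
- case=> [/tuple1E[A ->] /tuple1E[B ->]|/tuple2E[A [B ->]] /tuple2E[C [D ->]]] /=.
  + move=> /f_pointP; rewrite (tnth_nth A) /= => rA.
    move=> /f_pointP; rewrite (tnth_nth A) /= => rB.
    rewrite (eq_pointP _) !(tnth_nth A) /= (same_radicalP rA rB); split=> [BA|->].
      by apply/esym/vline_eq => //; apply: represents_neq0.
    exact: memv_line.
  + move=> /f_lineP; rewrite !(tnth_nth A) /= => rAB.
    move=> /f_lineP; rewrite !(tnth_nth A) /= => rCD.
    have [rC rD _] := represents_line_lines rCD.
    rewrite (eq_lineP _) !(tnth_nth A) /= !(radical_on_lineP rAB) //.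
    have /represents_lineP[_ _ CD] := rCD.
    split=> [[CAB DAB]|->]; last by rewrite mem_span2l mem_span2r.
    apply: span2_eq; rewrite ?dim_span2_le //; first exact: represents_neq0.
    exact: eta_neq0_notin.
- exists f_inc => /tuple1E[C ->] /tuple2E[A [B ->]] /=.
  move=> /f_pointP; rewrite (tnth_nth A) /= => rC.
  move=> /f_lineP; rewrite !(tnth_nth A) /= => rAB.
  by rewrite (f_incP _) !(tnth_nth A) /= (radical_on_lineP rAB rC) -memvE.
case.
  exists below_point, above_point => /tuple1E[A ->] m /=.
  move=> /f_pointP; rewrite (tnth_nth A) /= => rA.
  rewrite (below_pointP _) (above_pointP _) !(tnth_nth A) /=; split.
    exact: sub_radicalP.
  by split=> [[]//|]; move/negP: (not_sub_radical m rA).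
exists below_line, above_line => /tuple2E[A [B ->]] m /=.
move=> /f_lineP; rewrite !(tnth_nth A) /= => rAB.
have [rA rB _] := represents_line_lines rAB.
rewrite (below_lineP _) (above_lineP _) !(tnth_nth A) /=; split.
  by rewrite !sub_radicalP // subv_add; split=> [[-> ->]|/andP].
exact: sub_decode_line.
Qed.

End Geometry.

(** * Eight scalars *)

Section Scalars.

Variables (F : fieldType) (V : vectType F).
Hypothesis six_points : lines_have_at_least V 6.
Hypothesis dim_ge2 : (2 <= \dim {:V})%N.

(** A line [<x, y>] has the points [<y>] and [<x + t y>]; if all scalars were
    among the at most four elements of [T], these would be at most five
    points. *)
Lemma scalar_notin (T : seq F) : (size T <= 4)%N -> exists t, t \notin T.
Proof.
move=> leT; have x0 : vpick {:V} != 0.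
  by rewrite vpick0 -dimv_eq0 -lt0n; apply: ltnW.
set x := vpick _ in x0; have [y _ yx] : exists2 y, y \in {:V}%VS & y \notin <[x]>%VS.
  by apply: dim_lt_notin; rewrite dim_vline x0.
have [s [s_uniq size_s sL]] := six_points (dim_span2 x0 yx).
apply: NNPP => noT.
have sub : {subset s <= <[y]>%VS :: [seq <[x + t *: y]>%VS | t <- T]}.
  move=> P /sL[dP PL]; have [w w0 PE] := dim1_line dP.
  move: PL; rewrite PE -memvE => /mem_span2[a [b wE]]; rewrite inE.
  have [a0|a0] := eqVneq a 0.
    by rewrite (@vline_eq _ _ w y) ?eqxx // wE a0 scale0r add0r memvZ ?memv_line.
  apply/orP; right; apply/mapP; exists (b / a).
    by apply: contraT => bT; case: noT; exists (b / a).
  apply: vline_eq => //; apply/vlineP; exists a.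
  by rewrite scalerDr scalerA mulrC divfK.
have := uniq_leq_size s_uniq sub.
by rewrite size_s /= size_map ltnS leqNgt ltnS leT.
Qed.

(** In characteristic two [0, 1, a, a + 1] is an additive subgroup; together with
    another coset it has eight elements. *)
Lemma eight_scalars : 2%N \in [pchar F] -> exists s : seq F, uniq s /\ size s = 8%N.
Proof.
move=> char2; have xx (x : F) : x + x = 0 := addrr_pchar2 char2 x.
have [a] := @scalar_notin [:: 0; 1] isT; rewrite !inE negb_or => /andP[a0 a1].
pose s4 := [:: 0; 1; a; a + 1]; have [b bs4] := @scalar_notin s4 isT.
have s4D : {in s4 &, forall x y, x + y \in s4}.
  have e1 : 1 + (a + 1) = a by rewrite addrCA xx addr0.
  have e2 : a + (a + 1) = 1 by rewrite addrA xx add0r.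
  have e3 : a + 1 + 1 = a by rewrite -addrA xx addr0.
  have e4 : a + 1 + a = 1 by rewrite addrAC xx add0r.
  move=> x y; rewrite !inE => /or4P[]/eqP-> /or4P[]/eqP->;
  by rewrite ?addr0 ?add0r ?xx ?e1 ?e2 ?e3 ?e4 ?(addrC 1 a) ?eqxx ?orbT.
have uniq_s4 : uniq s4.
  have n1 : 0 != a + 1 by rewrite eq_sym addr_eq0 (oppr_pchar2 char2).
  have n2 : 1 != a + 1 by rewrite -{1}[1]add0r (inj_eq (addIr 1)) eq_sym.
  have n3 : a != a + 1 by rewrite -{1}[a]addr0 (inj_eq (addrI a)) eq_sym oner_neq0.
  rewrite /= !inE !negb_or n1 n2 n3 (eq_sym 0 1) oner_neq0 (eq_sym 0 a) a0.
  by rewrite (eq_sym 1 a) a1.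
exists (s4 ++ [seq x + b | x <- s4]); split; last by [].
rewrite cat_uniq uniq_s4 map_inj_uniq ?uniq_s4; last exact: addIr.
rewrite andbT; apply/hasPn => _ /mapP[x xs ->]; apply: contra bs4 => xbs.
by have := s4D _ _ xs xbs; rewrite addrA xx add0r.
Qed.

End Scalars.

(** * From the symmetric form to the alternating one *)

Section Form.

Variables (F : fieldType) (V : vectType F) (xi : {symmetric V}).
Variables (H b : {vspace V}).
Hypothesis char2 : 2%N \in [pchar F].
Hypothesis F_perfect : perfect_field F.
Hypothesis xi_nondegenerate : nondegenerate xi.
Hypothesis xi_not_alternating : exists u : V, xi u u <> 0.
Hypothesis H_selfconjugate : is_selfconjugate_locus xi H.
Hypothesis b_pole : is_pole xi b H.

Lemma xi_sym u v : xi u v = xi v u.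
Proof. by rewrite hermC expr0 mul1r. Qed.

Lemma xi_lin w a u v : xi w (a *: u + v) = a * xi w u + xi w v.
Proof. by rewrite linearDr linearZr_LR. Qed.

Lemma xi_eq0 w : (forall v, xi w v = 0) -> w = 0.
Proof.
move=> w0; apply/eqP; rewrite -memv0 -(eqP xi_nondegenerate).
by apply/mem_orthovP => v _.
Qed.

(** The pole is spanned by some [b0] such that [xi u u = 0] iff [xi b0 u = 0].
    Choosing [u1] with [xi b0 u1 = 1] gives [v = xi b0 v u1 + h] with
    [xi h h = 0]; the cross terms of [xi v v] cancel in characteristic two, so
    [xi v v] is [xi b0 v ^+ 2] times [xi u1 u1], which is a square. *)
Lemma square_root_vector : exists beta,
  [/\ beta != 0, b = <[beta]>%VS & forall u, xi u u = xi beta u ^+ 2].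
Proof.
have [db HE] := b_pole; have [b0 b00 bE] := dim1_line db.
have xi0 u : (xi b0 u == 0) = (xi u u == 0).
  have [->|u0] := eqVneq u 0.
    by rewrite !linear0r.
  rewrite xi_sym -mem_orthov1 -bE HE memvE H_selfconjugate ?dim_vline ?u0 //.
  by rewrite /selfconjugate orthov11.
have [u /eqP u_nz] := xi_not_alternating; rewrite -xi0 in u_nz.
pose u1 := (xi b0 u)^-1 *: u.
have bu1 : xi b0 u1 = 1 by rewrite /u1 -[_ *: u]addr0 xi_lin linear0r addr0 mulVf.
have [s sE] := F_perfect char2 (xi u1 u1).
have s0 : s != 0.
  apply: contraTneq (oner_neq0 F) => s0.
  by rewrite -bu1 negbK xi0 sE s0 expr0n.
exists (s *: b0); split.
- by rewrite scaler_eq0 negb_or s0.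
- rewrite bE; apply: vline_eq => //; apply/vlineP; exists s^-1.
  by rewrite scalerK.
move=> v; rewrite (xi_sym (s *: b0)) -[s *: b0]addr0 xi_lin linear0r addr0 (xi_sym v b0).
set k := xi b0 v; pose h := v - k *: u1.
have h0 : xi h h = 0.
  by apply/eqP; rewrite -xi0 /h addrC -scaleNr xi_lin bu1 mulr1 addNr.
have vE : v = k *: u1 + h by rewrite /h addrC subrK.
have kh0 : k * xi u1 h + k * xi u1 h = 0 := addrr_pchar2 char2 _.
have -> : xi v v = k * (k * xi u1 u1 + xi u1 h) + (k * xi u1 h + xi h h).
  rewrite {2}vE xi_lin (xi_sym v u1) (xi_sym v h) {1 2}vE !xi_lin.
  by rewrite (xi_sym h u1).
rewrite h0 sE addr0 mulrDr -addrA kh0 addr0; ring.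
Qed.

Lemma regularP U : regular xi U <->
  (forall w, w \in U -> (forall v, v \in U -> xi w v = 0) -> w = 0).
Proof.
rewrite /regular -subv0; split=> [/subvP reg w wU w_rad|reg].
  apply/eqP; rewrite -memv0; apply: reg; rewrite memv_cap wU.
  by apply/mem_orthovP.
apply/subvP => w; rewrite memv_cap memv0 => /andP[wU /mem_orthovP w_rad].
by apply/eqP/reg.
Qed.

(** It suffices to translate regularity, the hyperplane and the pole in terms of
    [lam] and [eta]. *)
Lemma definable_dim_ge4 (off_kernel : bool) :
  lines_have_at_least V 6 -> (4 <= \dim {:V})%N ->
  definable_in_terms_of (B1 xi H b) (if off_kernel then C2 xi H b else B2 xi b).
Proof.
move=> six dim4; have [beta [beta0 bE xi_beta]] := square_root_vector.
have [scalars [scalars_uniq size_scalars]] := eight_scalars six (ltnW (ltnW dim4)) char2.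
pose lam u := xi beta u; pose eta u v := xi u v - lam u * lam v.
have xiE u v : xi u v = eta u v + lam u * lam v by rewrite subrK.
have lam_lin a u v : lam (a *: u + v) = a * lam u + lam v by apply: xi_lin.
have eta_lin w a u v : eta w (a *: u + v) = a * eta w u + eta w v.
  by rewrite /eta xi_lin lam_lin; ring.
have eta_anti u v : eta u v = - eta v u.
  by rewrite (oppr_pchar2 char2) /eta xi_sym [lam u * _]mulrC.
have eta_alt u : eta u u = 0 by rewrite /eta xi_beta -expr2 subrr.
have lam_beta : lam beta = 0 \/ lam beta = 1.
  have : lam beta * (lam beta - 1) = 0.
    by rewrite mulrBr mulr1 -expr2 {2}/lam xi_beta subrr.
  move/eqP; rewrite mulf_eq0 subr_eq0 => /orP[]/eqP->; by [left|right].
have eta_beta v : eta beta v = lam v * (1 - lam beta).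
  by rewrite /eta -/(lam v); ring.
have lam_neq0 : exists v, lam v != 0.
  have [u u_nz] := xi_not_alternating; exists u; apply/eqP => lu.
  by apply: u_nz; rewrite xi_beta -/(lam u) lu expr0n.
have multiple k w : (forall v, xi w v = k * lam v) -> w \in <[beta]>%VS.
  move=> wk; apply/vlineP; exists k; apply/eqP; rewrite -subr_eq0; apply/eqP.
  apply: xi_eq0 => v; rewrite xi_sym -scaleNr addrC xi_lin (xi_sym v beta) (xi_sym v w) wk.
  by rewrite -/(lam v); ring.
have eta_rad w : (forall v, eta w v = 0) -> w \in <[beta]>%VS.
  by move=> w_rad; apply: (multiple (lam w)) => v; rewrite xiE w_rad add0r.
have eta_rad_ker w : lam w = 0 -> (forall v, lam v = 0 -> eta w v = 0) ->
    w \in <[beta]>%VS.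
  move=> lw w_rad; have [u lu] := lam_neq0.
  have xiw v : xi w v = eta w v by rewrite xiE lw mul0r addr0.
  apply: (multiple (xi w u / lam u)) => v.
  have lv0 : lam (- (lam v / lam u) *: u + v) = 0.
    by rewrite lam_lin mulNr divfK // addNr.
  have := w_rad _ lv0; rewrite -xiw xi_lin => /eqP.
  by rewrite mulNr addrC subr_eq0 => /eqP->; ring.
have regE U : regular xi U <-> nondegenerate_on lam eta U.
  rewrite regularP; split=> reg w wU w_rad; apply: reg => // v vU.
    by rewrite xiE w_rad.
  by rewrite -xiE w_rad.
have inH u : (u \in H) = (lam u == 0).
  by have [_ <-] := b_pole; rewrite bE mem_orthov1 xi_sym.
have notH U : ~~ (U <= H)%VS <-> exists2 u, u \in U & lam u != 0.
  split=> [/subvPn[u uU uH]|[u uU lu]]; first by exists u; rewrite -?inH.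
  by apply/subvPn; exists u; rewrite ?inH.
have bU U : (b <= U)%VS = (beta \in U) by rewrite bE -memvE.
have reg1 U : regular_of_dim xi 1 U <-> exists p, U = <[p]>%VS /\ lam p != 0.
  split=> [/andP[/eqP/dim1_line[p p0 ->] /regE reg]|[p [-> lp]]].
    by exists p; split=> //; apply/(nondegenerate_point lam_lin eta_lin eta_alt p0).
  have p0 : p != 0 by apply: contraNneq lp => ->; rewrite (lam0 lam_lin).
  apply/andP; rewrite dim_vline p0; split=> //.
  exact/regE/(nondegenerate_point lam_lin eta_lin eta_alt p0).
have reg2 U : regular_of_dim xi 2 U <->
    exists p y, U = (<[p]> + <[y]>)%VS /\ eta p y != 0.
  split=> [/andP[/eqP/dim2_span[p [y [-> p0 yp]]] /regE reg]|[p [y [-> py]]]].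
    exists p, y; split=> //.
    exact/(nondegenerate_line lam_lin eta_lin eta_anti eta_alt p0 yp).
  have p0 := eta_neq0_nz eta_lin eta_anti py.
  have yp := eta_neq0_notin eta_lin eta_alt py.
  apply/andP; rewrite dim_span2 //; split=> //.
  exact/regE/(nondegenerate_line lam_lin eta_lin eta_anti eta_alt p0 yp).
have reg3 U : regular_of_dim xi 3 U <->
    exists p y z, U = (<[p]> + <[y]> + <[z]>)%VS /\ om lam eta p y z != 0.
  split=> [/andP[/eqP/dim3_span[p [y [z [-> p0 yp zpy]]]] /regE reg]|].
    exists p, y, z; split=> //.
    exact/(nondegenerate_plane lam_lin eta_lin eta_anti eta_alt p0 yp zpy).
  case=> p [y [z [-> o]]].
  have p0 := om_neq0_nz lam_lin eta_lin eta_anti o.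
  have yp := om_neq0_notin lam_lin eta_lin eta_anti eta_alt o.
  have zpy := om_notin lam_lin eta_lin eta_anti eta_alt o.
  apply/andP; rewrite dim_add_line // dim_span2 //; split=> //.
  exact/regE/(nondegenerate_plane lam_lin eta_lin eta_anti eta_alt p0 yp zpy).
apply: (@interpretation _ _ lam eta beta lam_lin eta_lin eta_anti eta_alt beta0
  lam_beta eta_beta lam_neq0 eta_rad eta_rad_ker dim4 _ scalars_uniq size_scalars
  _ off_kernel) => U.
- have -> : points (if off_kernel then C2 xi H b else B2 xi b) U =
    [&& regular_of_dim xi 2 U, off_kernel ==> ~~ (U <= H)%VS & ~~ (b <= U)%VS].
    by case: off_kernel.
  split.
    case/and3P=> /reg2[p [y [UE py]]] /implyP UH; rewrite bU => bU'.
    by exists p, y; split=> // /UH/notH.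
  case=> p [y [UE py bU' UH]]; rewrite bU bU' andbT; apply/andP; split.
    by apply/reg2; exists p, y.
  by apply/implyP => /UH/notH.
- by have -> : lines (if off_kernel then C2 xi H b else B2 xi b) U =
    regular_of_dim xi 3 U by case: off_kernel.
- split=> [/andP[/reg1[p [UE lp]] Ub]|[p [UE lp pb]]].
    exists p; split=> //; apply: contra Ub => pb; rewrite UE bE.
    by apply/eqP/vline_eq => //; apply: contraNneq lp => ->; rewrite (lam0 lam_lin).
  apply/andP; split; first by apply/reg1; exists p.
  by apply: contra pb => /eqP Ub; rewrite -bE -Ub UE memv_line.
split=> [/andP[/reg2[p [y [UE py]]] /notH[w wU lw]]|[p [y [w [UE py wU lw]]]]].
  by exists p, y, w.
by apply/andP; split; [apply/reg2; exists p, y | apply/notH; exists w].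
Qed.

End Form.

Theorem theorem5p15 (F : fieldType) (V : vectType F) (xi : {symmetric V})
    (H b : {vspace V})
    (F_char2 : 2%N \in [pchar F])
    (F_perfect : perfect_field F)
    (dimV : \dim {:V} <> 2%N /\ \dim {:V} <> 3%N)
    (six_points : lines_have_at_least V 6)
    (xi_nondegenerate : nondegenerate xi)
    (xi_not_alternating : exists u : V, xi u u <> 0)
    (H_selfconjugate : is_selfconjugate_locus xi H)
    (b_pole : is_pole xi b H) :
  definable_in_terms_of (B1 xi H b) (B2 xi b) /\
  definable_in_terms_of (B1 xi H b) (C2 xi H b).
Proof.
have [dim_b _] := b_pole.
have [dim4|dim_le3] := leqP 4 (\dim {:V}).
  have main := @definable_dim_ge4 F V xi H b F_char2 F_perfect xi_nondegenerate
    xi_not_alternating H_selfconjugate b_pole _ six_points dim4.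
  by split; [apply: (main false) | apply: (main true)].
have dim_le1 : (\dim {:V} <= 1)%N.
  by case: dimV => /eqP + /eqP; move: dim_le3; case: (\dim _) => [|[|[|[|]]]].
(* In dimension one the only point is [b]. *)
have B1_empty s U : ~~ has_sort (B1 xi H b) s U.
  have dim_U := leq_trans (dimvS (subvf U)) dim_le1.
  case: s => /=; apply/negP => /andP[/andP[/eqP dU _]]; last by rewrite dU in dim_U.
  have full (W : {vspace V}) : \dim W = 1%N -> W = fullv.
    by move=> dW; apply/eqP; rewrite eqEdim subvf dW.
  by rewrite (full U dU) (full b dim_b) eqxx.
by split; apply: definable_empty.
Qed.
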